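(* Let $G_t(\lambda)$ be the limiting gap distribution function defined in the context, i.e. $G_t(\lambda)=\lim_{J\to\infty}G_{t,J}(\lambda)$. Then this limit exists in the following cases and is given by the following formulas. (1) When $t>2$, $$G_t(\lambda)=\begin{cases}1-\frac{\lambda t}{2}, & \text{if } 0\le\lambda\le\frac{2}{t};\\ 0, & \text{if } \frac{2}{t}\le\lambda.\end{cases}$$ (2) When $1<t\le 2$, $$G_t(\lambda)=\begin{cases}1+\frac{\lambda t}{2}+\lambda t\log\left(\frac{t}{2}\right)-\frac{\lambda t^2}{2}, & \text{if } 0\le\lambda\le 1;\\ 1-\frac{\lambda t}{2}+\lambda t\log\left(\frac{\lambda t}{2}\right)-\frac{\lambda t^2}{2}+t, & \text{if } 1\le\lambda\le\frac{2}{t};\\ 0, & \text{if } \frac{2}{t}\le\lambda.\end{cases}$$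
   Context: Fix $t>0$. For a positive integer $J$ (large enough that $tJ^2>J$) let $P_{t,J}=(-tJ^2,0)$ and $O=(0,0)$, and let $\mathcal R_J=\mathbb Z^2\cap([-J,J]\times[0,J])$, a set of $N=N_J=(2J+1)(J+1)$ lattice points. For $P\in\mathcal R_J$ consider the angle $\angle(P P_{t,J} O)$ at the vertex $P_{t,J}$ between the rays from $P_{t,J}$ to $P$ and to $O$. List these $N$ angles, with multiplicity, in nondecreasing order: $0=\alpha_1\le\alpha_2\le\dots\le\alpha_N=\alpha_{\max}$. Put $\Delta_{av}=\alpha_{\max}/N_J$ and, for $\lambda\ge 0$, $$G_{t,J}(\lambda)=\frac{1}{N_J}\#\{j:\ 1\le j\le N-1,\ \alpha_{j+1}-\alpha_j\ge\lambda\Delta_{av}\}.$$ The limiting gap distribution function is $G_t(\lambda)=\lim_{J\to\infty}G_{t,J}(\lambda)$. *)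

(* Defs.v *)
From HB Require Import structures.
From mathcomp Require Import all_boot all_order all_algebra.
From mathcomp Require Import all_classical all_reals all_analysis.
Set Implicit Arguments.
Unset Strict Implicit.
Unset Printing Implicit Defensive.
Import Order.TTheory GRing.Theory Num.Theory.
Import numFieldNormedType.Exports.
Local Open Scope ring_scope.

(* The norm that the library puts on R * R is the sup norm, hence an explicit
   Euclidean inner product and norm. *)
Definition dotp (R : realType) (u v : R * R) : R := u.1 * v.1 + u.2 * v.2.

Definition enorm (R : realType) (u : R * R) : R := Num.sqrt (dotp u u).

(* Unoriented angle at the vertex V, with values in [0, pi]. It is meaningful
   only for A != V and B != V. *)
Definition angle (R : realType) (A V B : R * R) : R :=
  acos (dotp (A - V) (B - V) / (enorm (A - V) * enorm (B - V))).

Definition lattice_box (J : nat) : seq (int * int) :=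
  [seq (a%:Z - J%:Z, b%:Z) | a <- iota 0 (2 * J + 1), b <- iota 0 (J + 1)].

Definition box_card (J : nat) : nat := ((2 * J + 1) * (J + 1))%N.

Lemma size_lattice_box (J : nat) : size (lattice_box J) = box_card J.
Proof. by rewrite size_allpairs !size_iota. Qed.

Lemma uniq_lattice_box (J : nat) : uniq (lattice_box J).
Proof.
apply: allpairs_uniq; rewrite ?iota_uniq //.
by move=> [a b] [c d] _ _ /= [/addIr [->] ->].
Qed.

Lemma mem_lattice_box (J : nat) (p : int * int) :
  (p \in lattice_box J) = (- J%:Z <= p.1 <= J%:Z) && (0 <= p.2 <= J%:Z).
Proof.
apply/allpairsP/idP => [[[a b]]|].
  rewrite !mem_iota /= !add0n !addn1 !ltnS => -[aJ bJ ->] /=.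
  by rewrite lerBlDr lerBrDr addNr !lez_nat bJ addnn -mul2n aJ.
case: p => x y /= /andP[/andP[xJ Jx] /andP[y0 yJ]].
have x0 : 0 <= x + J%:Z by rewrite -lerBlDr sub0r.
exists (absz (x + J%:Z), absz y); rewrite !mem_iota /= !add0n !addn1 !ltnS; split.
- by rewrite -lez_nat gez0_abs// mul2n -addnn PoszD lerD2r.
- by rewrite -lez_nat gez0_abs.
- by rewrite !gez0_abs// addrK.
Qed.

Definition viewpoint (R : realType) (t : R) (J : nat) : R * R :=
  (- (t * J%:R ^+ 2), 0).

Definition sorted_angles (R : realType) (t : R) (J : nat) : seq R :=
  sort <=%R
    [seq angle (p.1%:~R, p.2%:~R) (viewpoint t J) (0, 0) | p <- lattice_box J].

(* Numbered from 1: [alpha t J j] is the j-th smallest angle, 1 <= j <= N_J. *)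
Definition alpha (R : realType) (t : R) (J j : nat) : R :=
  nth 0 (sorted_angles t J) j.-1.

Definition average_gap (R : realType) (t : R) (J : nat) : R :=
  alpha t J (box_card J) / (box_card J)%:R.

Definition gap_distribution (R : realType) (t : R) (J : nat) (lambda : R) : R :=
  (count (fun j => lambda * average_gap t J <= alpha t J j.+1 - alpha t J j)
         (index_iota 1 (box_card J)))%:R / (box_card J)%:R.

(* Main.v *)
Require Import Defs.
From HB Require Import structures.
From mathcomp Require Import all_boot all_order all_algebra.
From mathcomp Require Import all_classical all_reals all_analysis.
From mathcomp Require Import ring lra zify.
Set Implicit Arguments.
Unset Strict Implicit.
Unset Printing Implicit Defensive.
Import Order.TTheory GRing.Theory Num.Theory.
Import numFieldNormedType.Exports.
Local Open Scope classical_set_scope.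
Local Open Scope ring_scope.

(** The point (a, b) of the box is seen at the angle atan (b / c), where
    c = t J^2 + a.  Two points p = (a, b) and q = (a', b') are therefore ordered
    by the sign of the integral combination cross p q = b' c - b c', and, all
    denominators being t^2 J^4 (1 + O(1/J)), the angle of q exceeds that of p by
    less than lambda average gaps when cross p q lies between 0 and about eta J,
    with eta = lambda t / 2 (close_of_cross, cross_of_close).  So, up to ties, the
    gaps to be counted correspond to the points p such that cross p q is in
    [0, eta J) for no other q (gap_distribution_le, gap_distribution_ge).

    In the row of p, cross takes the multiples of b: this requires b >= eta J.
    Row b + k gives the values k c - b d with d integer.  As t > 1, rows at
    distance 2 or more are out of reach, and for k = 1 or -1 the point p is
    blocked exactly when the fractional part of k c / b is less than eta J / b
    and the blocking point is in the box, which means k a < J - t J^2 / b up to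
    O(1); again because t > 1, rows b + 1 and b - 1 cannot both meet this last
    condition (gap_above_le, isolated_ge).

    It remains to know that, a being fixed, the fractional parts of c / b are
    equidistributed when b runs through an interval of length of order J
    (equidist).  Near b0 the function X / (b0 + r) of r is affine with slope
    - X / b0^2, up to O(1/J).  If p / q is a reduced fraction within 1 / (q Q) of
    X / b0^2, then q consecutive terms are spread like the multiples of 1 / q and
    hit an arc of length rho in q rho + O(1) points (block_count).  Dirichlet's
    theorem gives such a fraction with q <= Q.  The b0 for which q is below a
    fixed Q0 form boundedly many clusters of size O(J / Q) (near_rational_count);
    the others can be grouped in blocks with relative error O(1 / Q0).

    With x = b / J, a point of the row is hence kept with probability
    1 - (eta / x) max (0, 2 - t / x) if x >= eta, and 0 otherwise; the integral of
    this function over [0, 1] is limit_profile t eta (overlap_riemann_sum).  The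
    exact threshold is only bracketed between values of eta slightly below and
    slightly above lambda t / 2, and the continuity of limit_profile closes the
    argument (gap_distribution_cvg). *)

Local Notation "''1[' P ]" := ((nat_of_bool P%R)%:R) (at level 0, format "''1[' P ]").

(** * Fractional parts along one block *)

Lemma sum_indicator_le (R : realType) (n : nat) (P : pred nat) :
  \sum_(i < n) '1[P i] <= n%:R :> R.
Proof.
rewrite -[n in leRHS]card_ord -sumr_const; apply: ler_sum => i _.
by rewrite lern1 leq_b1.
Qed.

Lemma count_below_le (R : realType) (n : nat) (y : R) : 0 <= y + 1 ->
  \sum_(i < n) '1[i%:R < y] <= y + 1.
Proof.
move=> y1; elim: n => [|n IH]; first by rewrite big_ord0.
have [ny|yn] := ltP n%:R y.
  by apply: le_trans (sum_indicator_le R n.+1 (fun i => (i%:R < y)%R)) _; rewrite -natr1 lerD2r ltW.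
by rewrite big_ord_recr /= ltNge yn /= addr0.
Qed.

Lemma count_below_ge (R : realType) (n : nat) (y : R) : y <= n%:R ->
  y <= \sum_(i < n) '1[i%:R < y].
Proof.
elim: n => [|n IH] yn; first by rewrite big_ord0.
have [{}yn|ny] := leP y n%:R.
  by rewrite big_ord_recr /= (le_trans (IH yn))// lerDl.
rewrite (eq_bigr (fun _ => 1)) ?sumr_const ?card_ord// => i _.
by rewrite (le_lt_trans _ ny)// ler_nat -ltnS.
Qed.

Definition fracp (R : realType) (x : R) : R := x - (Num.floor x)%:~R.

Lemma fracp_ge0 (R : realType) (x : R) : 0 <= fracp x.
Proof. by rewrite subr_ge0 floor_le. Qed.

Lemma fracp_lt1 (R : realType) (x : R) : fracp x < 1.
Proof. by rewrite ltrBlDl -[1]/(1%:~R) -intrD floorD1_gt. Qed.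

Lemma fracp_eq (R : realType) (x : R) (m : int) :
  0 <= x - m%:~R < 1 -> fracp x = x - m%:~R.
Proof.
move=> /andP[h0 h1]; rewrite /fracp (@floor_def _ _ m)// intrD.
by rewrite -subr_ge0 h0 /= -ltrBlDl.
Qed.

Lemma affine_residue_inj (q : nat) (p s : int) : (0 < q)%N -> coprimez p q ->
  forall i j : 'I_q, (s + i%:Z * p = s + j%:Z * p %[mod q])%Z -> i = j.
Proof.
move=> q0 pq i j /eqP; rewrite eqz_modDl eqz_mod_dvd -mulrBl.
rewrite Gauss_dvdzl; last by rewrite /coprimez gcdzC.
rewrite -eqz_mod_dvd !modz_nat !modn_small// => /eqP[] ij.
exact: val_inj.
Qed.

(** Modulo 1, the numbers y r are within 3 / q of the points (s + r p) / q, which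
    are the q multiples of 1 / q in some order.  The length rho of the arc may
    itself vary by 1 / q with r.  The upper bound allows the left end point of
    the arc, the lower bound excludes it: this makes ties harmless later. *)
Lemma block_count (R : realType) (q : nat) (p s : int) (y rho : nat -> R) (rho0 : R) :
  (0 < q)%N -> coprimez p q -> 0 <= rho0 <= 1 ->
  (forall r, (r < q)%N -> `|q%:R * y r - (s + r%:Z * p)%:~R| <= 3) ->
  (forall r, (r < q)%N -> q%:R * `|rho r - rho0| <= 1) ->
  \sum_(r < q) '1[fracp (y r) < rho r] <= q%:R * rho0 + 9 /\
  q%:R * rho0 - 9 <= \sum_(r < q) '1[0 < fracp (y r) < rho r].
Proof.
move=> q0 pq /andP[rho00 rho01] hy hrho.
have q0R : 0 < q%:R :> R by rewrite ltr0n.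
pose kn (r : 'I_q) : nat := absz ((s + r%:Z * p) %% q)%Z.
have kz (r : 'I_q) : (kn r)%:Z = ((s + r%:Z * p) %% q)%Z.
  by rewrite gez0_abs// modz_ge0// -lt0n.
have kq (r : 'I_q) : (kn r < q)%N by rewrite -ltz_nat kz ltz_pmod.
pose k (r : 'I_q) : 'I_q := Ordinal (kq r).
have k_inj : injective k.
  move=> i j /(congr1 val)/(congr1 Posz) /=; rewrite !kz.
  exact: affine_residue_inj.
have kE (G : 'I_q -> R) : \sum_(r < q) G (k r) = \sum_(r < q) G r.
  by rewrite [RHS](reindex_inj k_inj).
have [j jE] : exists j : 'I_q -> int, forall r : 'I_q,
    (s + r%:Z * p)%:~R = q%:R * (j r)%:~R + (k r)%:R :> R.
  exists (fun r : 'I_q => (s + r%:Z * p) %/ q)%Z => r /=.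
  rewrite {1}(divz_eq (s + r%:Z * p) q) -kz intrD intrM mulrC.
  by rewrite -!pmulrn.
have qr (r : 'I_q) := hy r (ltn_ord r).
have rr (r : 'I_q) : `|q%:R * rho r - q%:R * rho0| <= 1.
  by rewrite -mulrBr normrM gtr0_norm// hrho.
(* Away from the seam 0 = 1 of the circle the floor of y r is j r. *)
have fr (r : 'I_q) : 4 <= (k r)%:R :> R -> (k r)%:R + 4 <= q%:R :> R ->
    fracp (y r) = y r - (j r)%:~R.
  move=> k3 kq3; apply: fracp_eq; move: (qr r); rewrite jE ler_norml.
  move=> /andP[h1 h2].
  have e1 : 0 <= q%:R * (y r - (j r)%:~R) by lra.
  have e2 : q%:R * (y r - (j r)%:~R) < q%:R * 1 by lra.
  by rewrite -(pmulr_rge0 (y r - (j r)%:~R) q0R) e1 -(ltr_pM2l q0R (y r - (j r)%:~R)).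
split.
- have -> : q%:R * rho0 + 9 = 4 + ((q%:R * rho0 + 4) + 1) by ring.
  apply: (@le_trans _ _ (\sum_(r < q)
     ('1[(rev_ord (k r))%:R < 4 - 1 :> R] + '1[(k r)%:R < q%:R * rho0 + 4]))).
    apply: ler_sum => r _; have [fy|_] /= := ltP (fracp (y r)) (rho r); last by rewrite addr_ge0.
    have [kr|kr] := ltP ((q - (kn r).+1)%:R : R) (4 - 1); first by rewrite lerDl.
    rewrite natrB// in kr; rewrite add0r.
    suff -> : (kn r)%:R < q%:R * rho0 + 4 by [].
    have kq3 : (kn r)%:R + 4 <= q%:R :> R by move: kr; rewrite -(natr1 (kn r)); lra.
    have [k4|k4] := ltP (kn r)%:R (4 : R).
      by rewrite (lt_le_trans k4)//; have := mulr_ge0 (ltW q0R) rho00; lra.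
    move: fy; rewrite fr// -(ltr_pM2l q0R (y r - (j r)%:~R)) => fy.
    move: (qr r) (rr r); rewrite jE.
    rewrite !ler_norml !mulrBr /= in fy *; move=> /andP[h1 h2] /andP[h3 h4].
    by lra.
  rewrite big_split /= lerD//.
    rewrite [leLHS](kE (fun i => '1[(rev_ord i)%:R < 4 - 1 :> R])).
    rewrite [leLHS](_ : _ = \sum_(i < q) '1[i%:R < 4 - 1 :> R]); last first.
      by rewrite [RHS](reindex_inj rev_ord_inj).
    apply: le_trans (count_below_le _ _) _; lra.
  rewrite [leLHS](kE (fun i => '1[i%:R < q%:R * rho0 + 4])).
  by apply: count_below_le; have := mulr_ge0 (ltW q0R) rho00; lra.
- apply: (@le_trans _ _ (\sum_(r < q)
     ('1[(k r)%:R < q%:R * rho0 - 4] - '1[(k r)%:R < 4 :> R]))).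
    rewrite sumrB (kE (fun i => '1[i%:R < q%:R * rho0 - 4])).
    rewrite (kE (fun i => '1[i%:R < 4 :> R])).
    have h1 := @count_below_ge R q (q%:R * rho0 - 4) _.
    have h2 := @count_below_le R q 4 _.
    have := ler_piMr (ltW q0R) rho01 => h3.
    have {}h1 := h1 ltac:(lra); have {}h2 := h2 ltac:(lra); lra.
  apply: ler_sum => r _.
  have [k4|k4] /= := ltP (kn r)%:R (4 : R).
    by rewrite (@le_trans _ _ 0)// subr_le0 lern1 leq_b1.
  have [kq3|] /= := ltP (kn r)%:R (q%:R * rho0 - 4); last by rewrite subr0.
  rewrite subr0 (_ : _ < _ < _)//.
  have := ler_piMr (ltW q0R) rho01 => h0.
  rewrite fr//=; last by lra.
  move: (qr r) (rr r); rewrite jE.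
  rewrite !ler_norml => /andP[h1 h2] /andP[h3 h4].
  rewrite -(pmulr_rgt0 (y r - (j r)%:~R) q0R) -(ltr_pM2l q0R (y r - (j r)%:~R)).
  rewrite !mulrBr /= in h1 h2 h3 h4 *.
  by apply/andP; split; lra.
Qed.

(** * Dirichlet approximation and clusters of integers *)

(** Pigeonhole on the fractional parts of i theta, followed by division by the gcd,
    since block_count needs a reduced fraction. *)
Lemma dirichlet_approx (R : realType) (theta : R) (Q : nat) : (0 < Q)%N ->
  exists q : nat, exists p : int,
    [/\ (0 < q <= Q)%N, coprimez p q & `|q%:R * theta - p%:~R| <= Q%:R^-1].
Proof.
move=> Q0; have Q0R : 0 < Q%:R :> R by rewrite ltr0n.
pose x (i : 'I_Q.+1) : R := Q%:R * fracp (i%:R * theta).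
have x0 i : 0 <= x i by rewrite mulr_ge0// fracp_ge0.
have box i : (Num.trunc (x i) < Q)%N.
  rewrite truncn_lt_nat//.
  by rewrite -[ltRHS]mulr1 ltr_pM2l// fracp_lt1.
pose f i : 'I_Q := Ordinal (box i).
have : ~~ injectiveb f.
  apply/negP => /injectiveP/leq_card; by rewrite !card_ord ltnn.
case/injectivePn => i [j ij fij].
wlog ltij : i j ij fij / (j < i)%N.
  move=> H; case: (ltngtP j i) => h; first exact: (H i j).
    by apply: (H j i) => //; rewrite eq_sym.
  by move: ij; rewrite -val_eqE /= h eqxx.
have xij : `|x i - x j| < 1.
  have /andP[h1 h2] := truncn_itv (x0 i); have /andP[h3 h4] := truncn_itv (x0 j).
  move: (congr1 val fij) h1 h2 h3 h4 => /= ->.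
  rewrite -natr1 ltr_norml => *; apply/andP; split; lra.
pose p := Num.floor (i%:R * theta) - Num.floor (j%:R * theta).
pose q := (i - j)%N.
have q0 : (0 < q)%N by rewrite subn_gt0.
have hqp : `|q%:R * theta - p%:~R| <= Q%:R^-1.
  rewrite -(ler_pM2l Q0R) mulfV ?gt_eqF// -[in leLHS](gtr0_norm Q0R) -normrM.
  apply/ltW; congr (_ < _): xij; congr `|_|.
  by rewrite /x /fracp /p /q natrB ?(ltnW ltij)// intrB; ring.
pose g := gcdn (absz p) q.
have g0 : (0 < g)%N by rewrite gcdn_gt0 q0 orbT.
have g0R : 0 < g%:R :> R by rewrite ltr0n.
have qE : q = ((q %/ g) * g)%N by rewrite divnK// dvdn_gcdr.
have gp : (g %| p)%Z by rewrite dvdzE /= dvdn_gcdl.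
have pE : p = ((p %/ g)%Z * g)%Z by rewrite divzK.
exists (q %/ g)%N, (p %/ g)%Z; split.
- rewrite divn_gt0// dvdn_leq ?dvdn_gcdr//=.
  by rewrite (leq_trans (leq_div _ _))// (leq_trans (leq_subr _ _))// -ltnS.
- rewrite /coprimez /gcdz /=; apply/eqP; congr Posz.
  apply/eqP; rewrite -(eqn_pmul2r g0) mul1n muln_gcdl -qE.
  by rewrite -[X in (_ * X)%N]/(absz g) -abszM -pE.
- apply: le_trans hqp; rewrite {2}qE {2}pE intrM natrM -pmulrn.
  rewrite (_ : _ * g%:R * theta - _ = g%:R * ((q %/ g)%:R * theta - (p %/ g)%Z%:~R)); last by ring.
  by rewrite normrM gtr0_norm// ler_peMl// ler1n.
Qed.

(** From its least element m on, the set is contained in [m, m + D + 1), and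
    count_below_le bounds the number of integers of this interval. *)
Lemma sum_spread (R : realType) (P : pred nat) (D : R) (n B : nat) : 0 <= D ->
  (forall b b', (B <= b <= b')%N -> (b' < B + n)%N -> P b -> P b' -> b'%:R - b%:R <= D) ->
  \sum_(B <= b < B + n) '1[P b] <= D + 2.
Proof.
move=> D0; elim: n B => [|n IH] B H; first by rewrite addn0 big_geq// addr_ge0.
rewrite addnS big_ltn ?ltnS ?leq_addr// -addSn.
have [PB|PB] /= := boolP (P B); last first.
  rewrite add0r; apply: IH => b b' /andP[h1 h2] h3.
  by apply: H => //; [rewrite (ltnW h1)|rewrite addnS].
rewrite (_ : D + 2 = 1 + (D + 1)); last by ring.
rewrite lerD2l; apply: (@le_trans _ _ (\sum_(i < n) '1[i%:R < D])); last first.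
  by apply: count_below_le; lra.
rewrite -[B.+1 in leLHS]add0n big_addn addKn big_mkord.
apply: ler_sum => i _; have [Pi|] //= := boolP (P _).
suff -> : i%:R < D by [].
have := H B (i + B.+1)%N _ _ PB Pi; rewrite addnS -natr1 natrD => h.
have := h _ _; rewrite leqnn ltnW ?ltnS ?leq_addl//= addnS ltnS addnC ltn_add2l ltn_ord.
by move=> /(_ isT isT); lra.
Qed.

(** * Places where the slope is close to a fraction of small denominator *)

Definition near_int (R : realType) (d y : R) : bool :=
  `[< exists p : int, `|y - p%:~R| <= d >].

Lemma near_int_le_sum (R : realType) (d y : R) (M : nat) : d <= 1 -> `|y| <= M%:R ->
  '1[near_int d y] <=
  \sum_(i < 2 * M + 3) '1[`|y - (i%:R - (M%:R + 1))| <= d] :> R.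
Proof.
move=> d1 yM; have [/asboolP[p hp]|_] /= := boolP (near_int d y); last first.
  by apply: sumr_ge0.
have pM : `|p| <= M%:Z + 1.
  rewrite -(ler_int R) intr_norm intrD -[in leRHS]pmulrn.
  have -> : p%:~R = y - (y - p%:~R) :> R by ring.
  by rewrite (le_trans (ler_normB _ _))// lerD// (le_trans hp).
have ilt : (absz (p + (M%:Z + 1))%R < 2 * M + 3)%N by lia.
rewrite (bigD1 (Ordinal ilt))//=.
set c := (X in '1[X] + _); suff -> : c by rewrite lerDl sumr_ge0.
rewrite {}/c; congr (_ <= _): hp; congr `|_ - _|.
have -> : (absz (p + (M%:Z + 1)))%:R = (p + (M%:Z + 1))%:~R :> R.
  by rewrite pmulrn gez0_abs//; lia.
by rewrite !intrD -!pmulrn; ring.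
Qed.

(** Each integer p with some Y / b^2 within d of it is at most M + 1 in absolute
    value, and the slope of Y / b^2 is at least a / J in absolute value, so the b
    attached to one p lie in an interval of length 2 d J / a. *)
Lemma count_near (R : realType) (Y h a d : R) (M B n J : nat) :
  0 < h -> 0 < a -> 0 <= d <= 1 -> (B + n <= J)%N -> h <= B%:R ->
  a * J%:R ^+ 2 <= `|Y| -> `|Y| <= M%:R * h ^+ 2 ->
  \sum_(B <= b < B + n) '1[near_int d (Y / b%:R ^+ 2)] <=
    (2 * M + 3)%:R * (2 * d / a * J%:R + 2) :> R.
Proof.
move=> h0 a0 /andP[d0 d1] BnJ hB aY YM.
apply: (@le_trans _ _ (\sum_(B <= b < B + n) \sum_(i < 2 * M + 3)
   '1[`|Y / b%:R ^+ 2 - (i%:R - (M%:R + 1))| <= d])).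
  rewrite big_nat [leRHS]big_nat; apply: ler_sum => b /andP[Bb _].
  apply: near_int_le_sum => //.
  have hb : h <= b%:R by rewrite (le_trans hB)// ler_nat.
  have b0 : 0 < b%:R :> R by apply: lt_le_trans hb.
  rewrite normrM normfV (ger0_norm (sqr_ge0 _)) ler_pdivrMr ?exprn_gt0//.
  by rewrite (le_trans YM)// ler_wpM2l// lerXn2r// ?nnegrE ltW.
rewrite exchange_big /= [leRHS](_ : _ = \sum_(i < 2 * M + 3) (2 * d / a * J%:R + 2)); last first.
  by rewrite sumr_const card_ord mulr_natl.
apply: ler_sum => i _; apply: sum_spread; first by rewrite !mulr_ge0// invr_ge0 ltW.
move=> b b' /andP[Bb bb'] b'B.
set m := i%:R - _; set x := Y / _; set x' := Y / _ => h1 h2.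
have hb : h <= b%:R by rewrite (le_trans hB)// ler_nat.
have b0 : 0 < b%:R :> R by apply: lt_le_trans hb.
have bb'R : b%:R <= b'%:R :> R by rewrite ler_nat.
have b'0 : 0 < b'%:R :> R by apply: lt_le_trans bb'R.
have b'J : b'%:R <= J%:R :> R by rewrite ler_nat (leq_trans (ltnW b'B)).
have J0 : 0 < J%:R :> R by apply: lt_le_trans b'J.
have xx' : `|x - x'| <= 2 * d.
  have -> : x - x' = (x - m) - (x' - m) by ring.
  by rewrite (le_trans (ler_normB _ _))// mulr2n mulrDl mul1r lerD.
have xE : x - x' = Y * ((b'%:R - b%:R) * ((b'%:R + b%:R) / (b%:R ^+ 2 * b'%:R ^+ 2))).
  by rewrite /x /x'; field; rewrite !gt_eqF.
have key : (J%:R ^+ 3)^-1 <= (b'%:R + b%:R) / (b%:R ^+ 2 * b'%:R ^+ 2) :> R.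
  rewrite ler_pdivlMr ?mulr_gt0 ?exprn_gt0// mulrC ler_pdivrMr ?exprn_gt0//.
  apply: (@le_trans _ _ (b'%:R * J%:R ^+ 3)); last first.
    by rewrite ler_wpM2r ?lerDl ?exprn_ge0 ?ltW.
  rewrite [b'%:R ^+ 2]expr2 mulrCA ler_wpM2l ?(ltW b'0)// (exprSr J%:R 2).
  rewrite ler_pM ?exprn_ge0 ?(ltW b0) ?(ltW b'0)//.
  by rewrite lerXn2r ?nnegrE ?(ltW b0) ?(ltW J0)// (le_trans bb'R).
rewrite -(ler_pM2l a0) (_ : a * (2 * d / a * _) = 2 * d * J%:R); last by field; rewrite gt_eqF.
have : a * J%:R ^+ 2 * ((b'%:R - b%:R) * (J%:R ^+ 3)^-1) <= 2 * d.
  apply: le_trans xx'; rewrite xE normrM.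
  have bb0 : 0 <= b'%:R - b%:R :> R by rewrite subr_ge0.
  rewrite [X in _ <= _ * X]ger0_norm; last first.
    by rewrite mulr_ge0// (le_trans _ key)// invr_ge0 exprn_ge0// ltW.
  apply: ler_pM => //; last by rewrite ler_wpM2l.
    by rewrite mulr_ge0 ?exprn_ge0 ?ler0n// ltW.
  by rewrite mulr_ge0// invr_ge0 exprn_ge0.
move=> /(ler_wpM2r (ltW J0)); congr (_ <= _).
by field; rewrite gt_eqF.
Qed.

(** The slope X / b^2 is within 1 / (q Q) of a fraction of denominator q, for some
    q < Q0: near such b a short block of X / b is not equidistributed. *)
Definition near_rational (R : realType) (X : R) (Q0 Q b : nat) : bool :=
  [exists q : 'I_Q0, (0 < q)%N && near_int Q%:R^-1 (q%:R * X / b%:R ^+ 2)].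

Lemma near_rational_count (R : realType) (X h a : R) (Q0 Q M B n J : nat) :
  0 < h -> 0 < a -> (0 < Q)%N -> (B + n <= J)%N -> h <= B%:R ->
  a * J%:R ^+ 2 <= `|X| -> Q0%:R * `|X| <= M%:R * h ^+ 2 ->
  \sum_(B <= b < B + n) '1[near_rational X Q0 Q b] <=
    Q0%:R * ((2 * M + 3)%:R * (2 * Q%:R^-1 / a * J%:R + 2)) :> R.
Proof.
move=> h0 a0 Q0' BnJ hB aX XM.
apply: (@le_trans _ _ (\sum_(B <= b < B + n) \sum_(q < Q0)
   '1[(0 < q)%N && near_int Q%:R^-1 (q%:R * X / b%:R ^+ 2)])).
  apply: ler_sum => b _; have [/existsP[q hq]|_] /= := boolP (near_rational X Q0 Q b); last first.
    by apply: sumr_ge0.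
  by rewrite (bigD1 q)//= hq lerDl sumr_ge0.
set c := (X in _ * X).
rewrite exchange_big /= [leRHS](_ : _ = \sum_(q < Q0) c); last first.
  by rewrite sumr_const card_ord mulr_natl.
apply: ler_sum => q _; have [q0|q0] /= := boolP (0 < q)%N; last first.
  by rewrite big1 // mulr_ge0// addr_ge0// mulr_ge0// divr_ge0 ?(ltW a0)// mulr_ge0// invr_ge0.
have q1 : 1 <= q%:R :> R by rewrite ler1n.
apply: (count_near h0 a0) => //.
- by rewrite invr_ge0 ler0n invf_le1 ?ltr0n// ler1n.
- by rewrite normrM ger0_norm// (le_trans aX)// ler_peMl.
- by rewrite normrM ger0_norm// (le_trans _ XM)// ler_wpM2r// ler_nat ltnW.
Qed.

(** * Equidistribution of fractional parts of X / b *)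

(** From b = B on, X / b stays within O(1 / q) of the affine function of slope
    - X / B^2 during q steps: the second-order term is at most Q^3 |X| / h^3 after
    multiplication by q. *)
Lemma good_block (R : realType) (X h : R) (Q0 Q B : nat) :
  0 < h -> (0 < Q)%N -> Q%:R ^+ 2 <= h -> Q%:R ^+ 3 * `|X| <= h ^+ 3 -> h <= B%:R ->
  ~~ near_rational X Q0 Q B ->
  exists q : nat, [/\ (0 < q <= Q)%N, (Q0 <= q)%N,
    \sum_(B <= b < B + q) '1[fracp (X / b%:R) < h / b%:R] <=
      \sum_(B <= b < B + q) h / b%:R + 10 &
    \sum_(B <= b < B + q) h / b%:R - 10 <=
      \sum_(B <= b < B + q) '1[0 < fracp (X / b%:R) < h / b%:R] :> R].
Proof.
move=> h0 Q_gt0 Q2h Q3X hB far.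
have B0 : 0 < B%:R :> R by apply: lt_le_trans hB.
have [q [p [/andP[q0 qQ] pq hqp]]] := dirichlet_approx (X / B%:R ^+ 2) Q_gt0.
exists q; rewrite q0 qQ.
have QR : 0 < Q%:R :> R by rewrite ltr0n.
have qQR : q%:R <= Q%:R :> R by rewrite ler_nat.
have qR : 0 < q%:R :> R by rewrite ltr0n.
pose y r : R := X / (r + B)%:R.
pose rho r : R := h / (r + B)%:R.
pose s := Num.floor (q%:R * X / B%:R).
have rQ r : (r < q)%N -> r%:R <= Q%:R :> R.
  by move=> rq; rewrite ler_nat (leq_trans (ltnW rq)).
have rB r : B%:R <= (r + B)%:R :> R by rewrite ler_nat leq_addl.
have rB0 r : 0 < (r + B)%:R :> R by apply: lt_le_trans (rB r).
have hy r : (r < q)%N -> `|q%:R * y r - (s + r%:Z * - p)%:~R| <= 3.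
  move=> rq; rewrite intrD intrM intrN -pmulrn.
  rewrite (_ : _ - _ = (fracp (q%:R * X / B%:R) - r%:R * (q%:R * (X / B%:R ^+ 2) - p%:~R))
     + q%:R * r%:R ^+ 2 * X / (B%:R ^+ 2 * (r + B)%:R)); last first.
    rewrite /fracp -/s /y; rewrite natrD; field.
    by rewrite -natrD !gt_eqF.
  rewrite (_ : 3 = (1 + 1) + 1); last by ring.
  apply: le_trans (ler_normD _ _) _; apply: lerD.
    apply: le_trans (ler_normB _ _) _; apply: lerD.
      by rewrite ger0_norm ?fracp_ge0// ltW// fracp_lt1.
    have := ler_pM (ler0n _ r) (normr_ge0 _) (rQ r rq) hqp.
    by rewrite mulfV ?lt0r_neq0// normrM ger0_norm.
  rewrite normrM normfV [X in _ / X]ger0_norm ?mulr_ge0 ?exprn_ge0//.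
  rewrite ler_pdivrMr ?mulr_gt0 ?exprn_gt0// mul1r normrM.
  rewrite [X in X * _]ger0_norm ?mulr_ge0 ?exprn_ge0//.
  apply: (@le_trans _ _ (Q%:R ^+ 3 * `|X|)).
    rewrite ler_wpM2r// (exprS Q%:R 2); apply: ler_pM; rewrite ?exprn_ge0//.
    by rewrite lerXn2r ?nnegrE//; apply: rQ.
  rewrite (le_trans Q3X)// (exprSr h 2); apply: ler_pM.
  - by rewrite exprn_ge0// ltW.
  - exact: ltW.
  - by rewrite lerXn2r ?nnegrE ?(ltW h0).
  - exact: le_trans (rB r).
have hrho r : (r < q)%N -> q%:R * `|rho r - h / B%:R| <= 1.
  move=> rq; rewrite /rho (_ : _ - _ = - (h * r%:R / (B%:R * (r + B)%:R))); last first.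
    by rewrite natrD; field; rewrite -natrD !gt_eqF.
  rewrite normrN ger0_norm; last first.
    by rewrite divr_ge0 ?mulr_ge0// ltW.
  rewrite mulrA ler_pdivrMr ?mulr_gt0// mul1r.
  apply: (@le_trans _ _ (Q%:R * (h * Q%:R))).
    by rewrite ler_pM ?mulr_ge0 ?(ltW h0)// ler_wpM2l ?(ltW h0)// rQ.
  rewrite (_ : _ * _ = Q%:R ^+ 2 * h); last by ring.
  rewrite ler_pM ?exprn_ge0 ?(ltW h0) ?(le_trans Q2h)//.
  exact: le_trans (rB r).
have rho1 : 0 <= h / B%:R <= 1.
  by rewrite divr_ge0 ?(ltW h0)//= ler_pdivrMr// mul1r.
have pq' : coprimez (- p) q by rewrite /coprimez gcdNz.
have [up low] := block_count q0 pq' rho1 hy hrho.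
have sE (F : nat -> R) : \sum_(B <= b < B + q) F b = \sum_(r < q) F (r + B)%N.
  by rewrite -{1}[B]add0n big_addn addKn big_mkord.
rewrite !sE.
have srho : `|\sum_(r < q) rho r - q%:R * (h / B%:R)| <= 1.
  rewrite (_ : q%:R * _ = \sum_(r < q) (h / B%:R)); last first.
    by rewrite sumr_const card_ord mulr_natl.
  rewrite -sumrB; apply: le_trans (ler_norm_sum _ _ _) _.
  apply: (@le_trans _ _ (\sum_(r < q) q%:R^-1)).
    by apply: ler_sum => r _; rewrite -(ler_pM2l qR) mulfV ?gt_eqF// hrho.
  by rewrite sumr_const card_ord -[_ *+ _]mulr_natl mulfV ?gt_eqF.
move: srho; rewrite ler_norml => /andP[s1 s2]; split=> //.
- rewrite leqNgt; apply: contra far => qQ0; apply/existsP; exists (Ordinal qQ0).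
  by rewrite /= q0; apply/asboolP; exists p; rewrite -mulrA.
- by rewrite -/(rho _); apply: le_trans up _; rewrite /rho in s1 *; lra.
- by apply: le_trans low; rewrite /rho in s2 *; lra.
Qed.

(** Read the interval from left to right, skipping one integer where the slope is
    close to a simple fraction and a whole block otherwise.  A block costs 10, that
    is 10 / Q0 per integer, and the last, incomplete one costs at most Q. *)
Lemma equidist_greedy (R : realType) (X h : R) (Q0 Q : nat) :
  0 < h -> (0 < Q0)%N -> (0 < Q)%N -> Q%:R ^+ 2 <= h -> Q%:R ^+ 3 * `|X| <= h ^+ 3 ->
  forall n B : nat, h <= B%:R ->
  \sum_(B <= b < B + n) '1[fracp (X / b%:R) < h / b%:R] <=
    \sum_(B <= b < B + n) h / b%:R +
    (10 / Q0%:R * n%:R + \sum_(B <= b < B + n) '1[near_rational X Q0 Q b] + Q%:R) /\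
  \sum_(B <= b < B + n) h / b%:R -
    (10 / Q0%:R * n%:R + \sum_(B <= b < B + n) '1[near_rational X Q0 Q b] + Q%:R) <=
  \sum_(B <= b < B + n) '1[0 < fracp (X / b%:R) < h / b%:R] :> R.
Proof.
move=> h0 Q0_gt0 Q_gt0 Q2h Q3X; elim/ltn_ind => n IH B hB.
have Q0R : 0 < Q0%:R :> R by rewrite ltr0n.
have rho01 b : (B <= b)%N -> 0 <= h / b%:R <= 1.
  move=> Bb; have hb : h <= b%:R by rewrite (le_trans hB)// ler_nat.
  have b0 := lt_le_trans h0 hb.
  by rewrite divr_ge0 ?(ltW h0)//= ler_pdivrMr// mul1r.
have near_ge0 m k : 0 <= \sum_(m <= b < k) '1[near_rational X Q0 Q b] :> R by apply: sumr_ge0.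
have [->|n0] := posnP n.
  by rewrite addn0 !big_geq// mulr0 !add0r oppr_le0.
have [nearB|far] := boolP (near_rational X Q0 Q B).
  have hB1 : h <= B.+1%:R by rewrite (le_trans hB)// ler_nat.
  have n1 : (n.-1 < n)%N by rewrite prednK.
  have [up low] := IH _ n1 _ hB1.
  have nE : n%:R = n.-1%:R + 1 :> R by rewrite natr1 prednK.
  have -> : (B + n = B.+1 + n.-1)%N by rewrite addSnnS prednK.
  have BB : (B < B.+1 + n.-1)%N by rewrite addSn ltnS leq_addr.
  rewrite !(@big_ltn _ _ _ B)//.
  have /andP[r0 r1] := rho01 B (leqnn B).
  have c0 : 0 <= 10 / Q0%:R :> R by rewrite divr_ge0.
  have i1 (b : bool) : '1[b] <= 1 :> R by case: b.
  have i0 (b : bool) : 0 <= '1[b] :> R by case: b.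
  have j1 := i1 (fracp (X / B%:R) < h / B%:R).
  have j0 := i0 (0 < fracp (X / B%:R) < h / B%:R).
  rewrite nearB nE mulrDr mulr1 /=; split; lra.
have [q [/andP[q0 qQ] Q0q up low]] := good_block h0 Q_gt0 Q2h Q3X hB far.
have [qn|nq] := leqP q n; last first.
  have e0 : 0 <= \sum_(B <= b < B + n) h / b%:R.
    by rewrite big_nat sumr_ge0// => b /andP[Bb _]; have /andP[] := rho01 b Bb.
  have e1 : \sum_(B <= b < B + n) h / b%:R <= n%:R.
    rewrite -[n in leRHS](addKn B) -[leRHS]mulr1 mulr_natl -sumr_const_nat.
    rewrite big_nat [leRHS]big_nat; apply: ler_sum => b /andP[Bb _].
    by have /andP[] := rho01 b Bb.
  have e2 (P : pred nat) : \sum_(B <= b < B + n) '1[P b] <= n%:R :> R.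
    rewrite -[n in leRHS](addKn B) -[leRHS]mulr1 mulr_natl -sumr_const_nat.
    by apply: ler_sum => b _; rewrite lern1 leq_b1.
  have e3 : 0 <= \sum_(B <= b < B + n) '1[0 < fracp (X / b%:R) < h / b%:R] :> R.
    exact: sumr_ge0.
  have e4 := e2 (fun b => (fracp (X / b%:R) < h / b%:R)%R).
  have nQ : n%:R <= Q%:R :> R by rewrite ler_nat (leq_trans (ltnW nq)).
  have c0 : 0 <= 10 / Q0%:R * n%:R :> R by rewrite mulr_ge0// divr_ge0.
  have := near_ge0 B (B + n)%N; split; lra.
have hBq : h <= (B + q)%:R by rewrite (le_trans hB)// ler_nat leq_addr.
have nqn : (n - q < n)%N by rewrite ltn_subrL q0.
have [up' low'] := IH _ nqn _ hBq.
have nE : n%:R = (n - q)%:R + q%:R :> R by rewrite -natrD subnK.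
have BnE : (B + q + (n - q) = B + n)%N by rewrite -addnA subnKC.
rewrite BnE in up' low'.
have l1 : (B <= B + q)%N by rewrite leq_addr.
have l2 : (B + q <= B + n)%N by rewrite leq_add2l.
rewrite !(@big_cat_nat _ _ _ (B + q) B (B + n))//=.
have c1 : 10 <= 10 / Q0%:R * q%:R :> R.
  by rewrite mulrAC ler_pdivlMr// ler_wpM2l// ler_nat.
have := near_ge0 B (B + q)%N; rewrite nE mulrDr; split; lra.
Qed.

Lemma nat_ub (R : realType) (x : R) : exists n : nat, (0 < n)%N /\ x <= n%:R.
Proof.
exists (Num.trunc x).+1; split=> //.
have [x0|x0] := leP 0 x; last by rewrite ltW// (lt_le_trans x0).
by have /andP[_ /ltW] := truncn_itv x0.
Qed.

(** The bound is uniform in X and B: only the order of magnitude of X matters.  The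
    parameters are chosen in the order Q0 (blocks are long), Q (exceptional
    integers are rare), then J. *)
Lemma equidist (R : realType) (a A eta e : R) :
  0 < a -> 0 < A -> 0 < eta -> 0 < e ->
  exists K : R, forall J : nat, K <= J%:R -> forall (X : R) (B : nat),
  a * J%:R ^+ 2 <= `|X| <= A * J%:R ^+ 2 -> eta * J%:R <= B%:R -> (B <= J)%N ->
  \sum_(B <= b < J) '1[fracp (X / b%:R) < eta * J%:R / b%:R] <=
    \sum_(B <= b < J) eta * J%:R / b%:R + e * J%:R /\
  \sum_(B <= b < J) eta * J%:R / b%:R - e * J%:R <=
    \sum_(B <= b < J) '1[0 < fracp (X / b%:R) < eta * J%:R / b%:R] :> R.
Proof.
move=> a0 A0 eta0 e0.
(* Complete blocks will cost e J / 2, exceptional integers e J / 4 + O(1). *)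
have [Q0 [Q0_gt0 hQ0]] := nat_ub (20 / e).
have [M [_ hM]] := nat_ub (Q0%:R * A / eta ^+ 2).
have [Q [Q_gt0 hQ]] := nat_ub (8 * Q0%:R * (2 * M + 3)%:R / (a * e)).
have Q0R : 0 < Q0%:R :> R by rewrite ltr0n.
have QR : 0 < Q%:R :> R by rewrite ltr0n.
set M3 : R := (2 * M + 3)%:R in hQ *.
have M30 : 0 < M3 by rewrite ltr0n addnS.
pose k1 := Q%:R ^+ 2 / eta; pose k2 := Q%:R ^+ 3 * A / eta ^+ 3.
pose k3 := 4 * (2 * Q0%:R * M3 + Q%:R) / e.
have k10 : 0 <= k1 by rewrite divr_ge0 ?exprn_ge0// ltW.
have k20 : 0 <= k2 by rewrite divr_ge0 ?mulr_ge0 ?exprn_ge0// ltW.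
have k30 : 0 <= k3 by rewrite divr_ge0 ?(ltW e0)// mulr_ge0// addr_ge0// !mulr_ge0// ltW.
exists (1 + k1 + k2 + k3) => J KJ X B /andP[aX XA] hB BJ.
have J0 : 0 < J%:R :> R by lra.
have h0 : 0 < eta * J%:R by rewrite mulr_gt0.
have hk1 : Q%:R ^+ 2 <= eta * J%:R.
  by rewrite mulrC -ler_pdivrMr// -/k1; lra.
have hk2 : Q%:R ^+ 3 * `|X| <= (eta * J%:R) ^+ 3.
  apply: (@le_trans _ _ (Q%:R ^+ 3 * (A * J%:R ^+ 2))).
    by rewrite ler_wpM2l ?exprn_ge0.
  rewrite (_ : (eta * J%:R) ^+ 3 = J%:R * eta ^+ 3 * J%:R ^+ 2); last by ring.
  rewrite mulrA ler_wpM2r ?exprn_ge0// -ler_pdivrMr ?exprn_gt0// -/k2; lra.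
have hXM : Q0%:R * `|X| <= M%:R * (eta * J%:R) ^+ 2.
  apply: (@le_trans _ _ (Q0%:R * (A * J%:R ^+ 2))); first by rewrite ler_wpM2l.
  rewrite (_ : _ * (eta * _) ^+ 2 = M%:R * eta ^+ 2 * J%:R ^+ 2); last by ring.
  by rewrite mulrA ler_wpM2r ?exprn_ge0//; move: hM; rewrite ler_pdivrMr ?exprn_gt0.
have BnJ : (B + (J - B) <= J)%N by rewrite subnKC.
have := near_rational_count h0 a0 Q_gt0 BnJ hB aX hXM.
have := equidist_greedy h0 Q0_gt0 Q_gt0 hk1 hk2 (J - B) hB.
rewrite subnKC// -/M3; set S := \sum_(B <= b < J) '1[near_rational X Q0 Q b].
move=> [up low] hS.
suff E : 10 / Q0%:R * (J - B)%:R + S + Q%:R <= e * J%:R.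
  by split; [apply: (le_trans up)|apply: le_trans low]; lra.
have E1 : 10 / Q0%:R * (J - B)%:R <= e / 2 * J%:R.
  apply: ler_pM; rewrite ?divr_ge0 ?ler_nat ?leq_subr//.
  by rewrite ler_pdivrMr//; move: hQ0; rewrite ler_pdivrMr//; lra.
have E2 : Q0%:R * (M3 * (2 * Q%:R^-1 / a * J%:R)) <= e / 4 * J%:R.
  rewrite !mulrA ler_wpM2r//.
  move: hQ; rewrite ler_pdivrMr ?mulr_gt0// => hQ.
  rewrite -(ler_pM2r (mulr_gt0 QR a0)).
  rewrite [leLHS](_ : _ = 2 * Q0%:R * M3); last by field; rewrite !lt0r_neq0.
  by lra.
have E3 : 2 * Q0%:R * M3 + Q%:R <= e / 4 * J%:R.
  have : k3 <= J%:R by lra.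
  by rewrite /k3 ler_pdivrMr//; lra.
by move: hS; rewrite !mulrDr; lra.
Qed.

(** * Riemann sums for the overlap of consecutive rows *)

Lemma sum_inv_bounds (R : realType) (B J : nat) : (0 < B <= J)%N ->
  `|\sum_(B <= b < J) b%:R^-1 - ln (J%:R / B%:R)| <= B%:R^-1 :> R.
Proof.
case/andP => B0 BJ; rewrite -(subnKC BJ); move: (J - B)%N => n.
have BR : 0 < B%:R :> R by rewrite ltr0n.
have step m : (0 < m)%N -> m.+1%:R^-1 <= @ln R (m.+1%:R / m%:R) <= m%:R^-1.
  move=> m0; have mR : 0 < m%:R :> R by rewrite ltr0n.
  have mR1 : 0 < m.+1%:R :> R by rewrite ltr0n.
  apply/andP; split.
    rewrite -[leRHS]opprK -lnV ?posrE ?divr_gt0// invf_div lerNr.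
    have -> : m%:R / m.+1%:R = 1 + - m.+1%:R^-1 :> R.
      by rewrite -[m.+1%:R]natr1; field; rewrite natr1 lt0r_neq0.
    by apply: le_ln1Dx; rewrite ltrN2 invf_lt1// ltr1n.
  have -> : m.+1%:R / m%:R = 1 + m%:R^-1 :> R.
    by rewrite -natr1; field; rewrite lt0r_neq0.
  by apply: le_ln1Dx; have : 0 < m%:R^-1 :> R by [rewrite invr_gt0]; lra.
suff : @ln R ((B + n)%:R / B%:R) <= \sum_(B <= b < B + n) b%:R^-1 <=
   @ln R ((B + n)%:R / B%:R) + (B%:R^-1 - (B + n)%:R^-1).
  case/andP => h1 h2; have : 0 <= (B + n)%:R^-1 :> R by rewrite invr_ge0.
  by move=> h3; rewrite ger0_norm; lra.
elim: n => [|n IH].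
  by rewrite addn0 big_geq// mulfV ?lt0r_neq0// ln1 subrr addr0 lexx.
have Bn : (0 < B + n)%N by rewrite addn_gt0 B0.
have BnR : 0 < (B + n)%:R :> R by rewrite ltr0n.
have /andP[s1 s2] := step (B + n)%N Bn.
have /andP[h1 h2] := IH; rewrite addnS big_nat_recr ?leq_addr//=.
have -> : (B + n).+1%:R / B%:R = ((B + n).+1%:R / (B + n)%:R) * ((B + n)%:R / B%:R) :> R.
  by field; rewrite -natrD !lt0r_neq0.
rewrite lnM ?posrE ?divr_gt0 ?ltr0n//.
move: h1 h2 s1 s2; set l1 := ln (_ / B%:R); set l2 := ln _; set S := \sum_(_ <= _ < _) _.
set i1 := (B + n)%:R^-1; set i2 := _.+1%:R^-1.
by move: l1 l2 S i1 i2 => *; apply/andP; split; lra.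
Qed.

Lemma sum_invsq_bounds (R : realType) (B J : nat) : (0 < B <= J)%N ->
  `|\sum_(B <= b < J) (b%:R ^+ 2)^-1 - (B%:R^-1 - J%:R^-1)| <= (B%:R ^+ 2)^-1 :> R.
Proof.
case/andP => B0 BJ; rewrite -(subnKC BJ); move: (J - B)%N => n.
have BR : 0 < B%:R :> R by rewrite ltr0n.
have step m : (0 < m)%N ->
    (m.+1%:R ^+ 2)^-1 <= ( m%:R^-1 - m.+1%:R^-1 : R) <= (m%:R ^+ 2)^-1.
  move=> m0; have mR : 0 < m%:R :> R by rewrite ltr0n.
  have mR1 : 0 < m.+1%:R :> R by rewrite ltr0n.
  have mm : m%:R <= m.+1%:R :> R by rewrite ler_nat.
  have -> : m%:R^-1 - m.+1%:R^-1 = (m%:R * m.+1%:R)^-1 :> R.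
    by rewrite -[m.+1%:R]natr1; field; rewrite natr1 !lt0r_neq0.
  by rewrite !lef_pV2 ?posrE ?mulr_gt0 ?exprn_gt0// !expr2 ler_wpM2r ?ler_wpM2l// ltW.
suff : B%:R^-1 - (B + n)%:R^-1 <= (\sum_(B <= b < B + n) (b%:R ^+ 2)^-1 : R) <=
   (B%:R^-1 - (B + n)%:R^-1) + ((B%:R ^+ 2)^-1 - ((B + n)%:R ^+ 2)^-1).
  case/andP => h1 h2.
  have : 0 <= ((B + n)%:R ^+ 2)^-1 :> R by rewrite invr_ge0 exprn_ge0.
  by move=> h3; rewrite ger0_norm; lra.
elim: n => [|n IH].
  by rewrite addn0 big_geq// !subrr addr0 lexx.
have Bn : (0 < B + n)%N by rewrite addn_gt0 B0.
have /andP[s1 s2] := step (B + n)%N Bn.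
have /andP[h1 h2] := IH; rewrite addnS big_nat_recr ?leq_addr//=.
move: h1 h2 s1 s2; set S := \sum_(_ <= _ < _) _.
set i1 := (B + n)%:R^-1; set i2 := _.+1%:R^-1.
set j1 := ((B + n)%:R ^+ 2)^-1; set j2 := (_.+1%:R ^+ 2)^-1.
by move: S i1 i2 j1 j2 => *; apply/andP; split; lra.
Qed.

Lemma monotone_threshold (W : pred nat) (J : nat) :
  (forall b b', (b <= b')%N -> W b -> W b') ->
  exists2 B, (B <= J)%N & forall b, (b < J)%N -> W b = (B <= b)%N.
Proof.
move=> mono; elim: J => [|J [B BJ HB]]; first by exists 0%N.
have [WJ|WJ] := boolP (W J).
  exists B; first exact: leqW.
  by move=> b; rewrite ltnS leq_eqVlt => /predU1P[->|/HB//]; rewrite WJ BJ.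
exists J.+1 => // b bJ; rewrite leqNgt bJ /=; apply/negbTE.
by apply: contra WJ; apply: mono.
Qed.

Lemma sum_threshold (R : realType) (W : pred nat) (F : nat -> R) (B J : nat) :
  (B <= J)%N -> (forall b, (b < J)%N -> W b = (B <= b)%N) ->
  \sum_(0 <= b < J) '1[W b] * F b = \sum_(B <= b < J) F b.
Proof.
move=> BJ HB; rewrite (@big_cat_nat _ _ _ B)//= [X in X + _]big1_seq ?add0r.
  by apply: eq_big_nat => b /andP[Bb bJ]; rewrite HB// Bb mul1r.
move=> b; rewrite mem_index_iota => /andP[_ /andP[_ bB]].
by rewrite HB ?(leq_trans bB)// leqNgt bB mul0r.
Qed.

(** The ratio b / J from which a row b >= eta J meets the next one. *)
Definition overlap_start (R : realType) (t eta : R) : R := Num.min 1 (Num.max eta (t / 2)).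

(** For 0 < eta <= 1, the integral of (eta / x) max (0, 2 - t / x) for x between
    eta and 1. *)
Definition overlap_loss (R : realType) (t eta : R) : R :=
  let beta := overlap_start t eta in eta * (t - 2 * ln beta - t / beta).

Lemma overlap_riemann_sum (R : realType) (t eta e : R) : 0 < t -> 0 < eta -> 0 < e ->
  exists K : R, forall J : nat, K <= J%:R ->
  `|\sum_(0 <= b < J) '1[eta * J%:R <= b%:R] *
       (eta * J%:R / b%:R * Num.max 0 (2 * J%:R - t * J%:R ^+ 2 / b%:R))
    - J%:R ^+ 2 * overlap_loss t eta| <= e * J%:R ^+ 2.
Proof.
move=> t0 eta0 e0; rewrite /overlap_loss; set beta := overlap_start t eta.
have beta0 : 0 < beta by rewrite /beta /overlap_start lt_min ltr01 lt_max eta0.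
have beta1 : beta <= 1 by rewrite /beta /overlap_start ge_min lexx.
pose K := eta * (4 / beta + 2 * t / beta ^+ 2) / e.
have K0 : 0 <= K.
  rewrite divr_ge0 ?(ltW e0)// mulr_ge0 ?(ltW eta0)// addr_ge0//.
    by rewrite divr_ge0 ?ltW.
  by rewrite divr_ge0 ?mulr_ge0 ?exprn_ge0 ?ltW.
exists (1 + K) => J KJ.
have J0 : 0 < J%:R :> R by lra.
have [B BJ HB] : exists2 B, (B <= J)%N &
    forall b, (b < J)%N -> (beta * J%:R <= b%:R) = (B <= b)%N.
  apply: monotone_threshold => b b' bb' h.
  by rewrite (le_trans h)// ler_nat.
have betaB : beta * J%:R <= B%:R.
  move: BJ; rewrite leq_eqVlt => /predU1P[->|BJ]; last by rewrite HB.
  by rewrite ler_piMl.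
have B0R : 0 < B%:R :> R by rewrite (lt_le_trans _ betaB)// mulr_gt0.
have B0 : (0 < B)%N by rewrite ltr0n in B0R.
have Bbeta : B%:R <= beta * J%:R + 1.
  have : ~~ (beta * J%:R <= B.-1%:R).
    by rewrite HB -?ltnNge ?prednK// (leq_trans _ BJ)// prednK.
  by rewrite -ltNge -[in B%:R](prednK B0) -natr1; lra.
rewrite (_ : \sum_(0 <= b < J) _ = \sum_(B <= b < J)
    (eta * J%:R ^+ 2 * (2 * b%:R^-1 - t * J%:R * (b%:R ^+ 2)^-1))); last first.
  rewrite -(sum_threshold _ BJ HB); apply: eq_big_nat => b /andP[_ bJ].
  have bJR : b%:R < J%:R :> R by rewrite ltr_nat.
  have [hb|hb] := leP (beta * J%:R) b%:R.
    have b0 : 0 < b%:R :> R by rewrite (lt_le_trans _ hb)// mulr_gt0.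
    have bm : Num.max eta (t / 2) < 1.
      rewrite ltNge; apply: contraL bJR => /min_idPl h; rewrite -leNgt.
      by move: hb; rewrite /beta /overlap_start h mul1r.
    have bE : beta = Num.max eta (t / 2) by apply/min_idPr/ltW.
    have -> : eta * J%:R <= b%:R.
      by rewrite (le_trans _ hb)// ler_pM2r// bE le_max lexx.
    have tb : t / 2 * J%:R <= b%:R.
      by rewrite (le_trans _ hb)// ler_pM2r// bE le_max lexx orbT.
    rewrite max_r; first by field; rewrite lt0r_neq0.
    rewrite subr_ge0 ler_pdivrMr// (_ : _ * b%:R = b%:R * (2 * J%:R)); last by ring.
    by rewrite (le_trans _ (ler_wpM2r _ tb)) ?mulr_ge0 ?(ltW J0)//; lra.
  rewrite mul0r; have [hb'|] := leP (eta * J%:R) b%:R; last by rewrite mul0r.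
  have b0 : 0 < b%:R :> R by rewrite (lt_le_trans _ hb')// mulr_gt0.
  rewrite max_l ?mulr0// subr_le0 ler_pdivlMr//.
  have : b%:R < t / 2 * J%:R.
    have : b%:R < Num.max eta (t / 2) * J%:R.
      by rewrite (lt_le_trans hb)// ler_pM2r// /beta /overlap_start ge_min lexx orbT.
    by rewrite maxr_pMl ?(ltW J0)// lt_max ltNge hb'.
  move=> /ltW /(ler_wpM2l (_ : 0 <= 2 * J%:R)); rewrite mulr_ge0 ?(ltW J0)// => /(_ isT).
  by move=> h; apply: (le_trans h); rewrite le_eqVlt; apply/orP; left; apply/eqP; field.
rewrite -mulr_sumr sumrB -!mulr_sumr.
have B0J : (0 < B <= J)%N by rewrite B0.
have := sum_inv_bounds R B0J; have := sum_invsq_bounds R B0J.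
set S1 := \sum_(B <= b < J) b%:R^-1; set S2 := \sum_(B <= b < J) _ => hS2 hS1.
have lnB : `|ln (J%:R / B%:R) + ln beta| <= (beta * J%:R)^-1.
  have p1 : 0 < beta * J%:R by rewrite mulr_gt0.
  have -> : ln (J%:R / B%:R) + ln beta = - ln (1 + (B%:R / (beta * J%:R) - 1)).
    rewrite -lnM ?posrE ?divr_gt0// -lnV ?posrE; last by rewrite addrC subrK divr_gt0.
    by congr ln; rewrite [1 + _]addrC subrK invf_div; field; rewrite !lt0r_neq0.
  have q0 : 0 <= B%:R / (beta * J%:R) - 1 by rewrite subr_ge0 ler_pdivlMr// mul1r.
  rewrite normrN ger0_norm ?ln_ge0 ?lerDl//.
  apply: le_trans (le_ln1Dx _) _; first by lra.
  by rewrite lerBlDr ler_pdivrMr// mulrDl mulVf ?lt0r_neq0// mul1r addrC.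
have iB : `|J%:R / B%:R - beta^-1| <= (beta ^+ 2 * J%:R)^-1.
  rewrite distrC (_ : _ - _ = (B%:R - beta * J%:R) / (beta * B%:R)); last first.
    by field; rewrite !lt0r_neq0.
  rewrite ger0_norm ?divr_ge0 ?subr_ge0 ?mulr_ge0 ?(ltW beta0)//.
  apply: (@le_trans _ _ (1 / (beta * B%:R))).
    by rewrite ler_wpM2r ?invr_ge0 ?mulr_ge0 ?(ltW beta0)//; lra.
  by rewrite mul1r lef_pV2 ?posrE ?mulr_gt0 ?exprn_gt0// expr2 -mulrA ler_pM2l.
have iB1 : B%:R^-1 <= (beta * J%:R)^-1 by rewrite lef_pV2 ?posrE ?mulr_gt0.
have iB2 : J%:R * (B%:R ^+ 2)^-1 <= (beta ^+ 2 * J%:R)^-1.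
  rewrite (_ : (beta ^+ 2 * J%:R)^-1 = J%:R * ((beta * J%:R) ^+ 2)^-1); last first.
    by field; rewrite !lt0r_neq0.
  rewrite ler_wpM2l ?(ltW J0)// lef_pV2 ?posrE ?exprn_gt0 ?mulr_gt0//.
  by rewrite lerXn2r ?nnegrE ?mulr_ge0 ?(ltW beta0).
set u := (beta * J%:R)^-1 in lnB iB1; set v := (beta ^+ 2 * J%:R)^-1 in iB iB2.
have total : eta * (4 * u + 2 * t * v) <= e.
  have -> : eta * (4 * u + 2 * t * v) = K * e / J%:R.
    by rewrite /u /v /K; field; rewrite !lt0r_neq0.
  by rewrite ler_pdivrMr// mulrC ler_pM2l//; lra.
have hS2' : `|J%:R * (S2 - (B%:R^-1 - J%:R^-1))| <= v.
  by rewrite normrM gtr0_norm// (le_trans _ iB2)// ler_pM2l.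
rewrite (_ : _ - _ = J%:R ^+ 2 * (eta * (2 * (S1 - ln (J%:R / B%:R))
  + 2 * (ln (J%:R / B%:R) + ln beta) - t * (J%:R * (S2 - (B%:R^-1 - J%:R^-1)))
  - t * (J%:R / B%:R - beta^-1)))); last by field; rewrite !lt0r_neq0.
rewrite normrM [X in X * _]ger0_norm ?exprn_ge0// mulrC ler_wpM2r ?exprn_ge0//.
rewrite normrM gtr0_norm// (le_trans _ total)// ler_pM2l//.
have {}hS1 := le_trans hS1 iB1.
have tv x : `|x| <= v -> `|t * x| <= t * v.
  by move=> xv; rewrite normrM gtr0_norm// ler_pM2l.
move: (tv _ hS2') (tv _ iB) hS1 lnB; rewrite !ler_norml.
move=> /andP[? ?] /andP[? ?] /andP[? ?] /andP[? ?].
by apply/andP; split; lra.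
Qed.

Lemma count_below_dist (R : realType) (J : nat) (Y z : R) : Y <= 2 * J%:R ->
  `|\sum_(i < 2 * J + 1) '1[i%:R < Y - z] - Num.max 0 Y| <= `|z| + 1.
Proof.
move=> YJ; have z1 := ler_norm z; have z2 := ler_norm (- z); rewrite normrN in z2.
have nE : (2 * J + 1)%:R = 2 * J%:R + 1 :> R by rewrite natrD natrM.
have S0 : 0 <= \sum_(i < 2 * J + 1) '1[i%:R < Y - z] :> R by apply: sumr_ge0.
have low : Y - `|z| <= \sum_(i < 2 * J + 1) '1[i%:R < Y - z].
  apply: le_trans (_ : Y - `|z| <= Num.min (Y - z) (2 * J + 1)%:R) _.
    by rewrite le_min nE; apply/andP; split; have := normr_ge0 z; lra.
  apply: le_trans (count_below_ge _) _; first by rewrite ge_min; apply/orP; right.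
  apply: ler_sum => i _; rewrite lt_min; case: (_ < Y - z) => //=.
  by rewrite lern1 leq_b1.
have up : \sum_(i < 2 * J + 1) '1[i%:R < Y - z] <= Num.max 0 Y + `|z| + 1.
  have [y0|y0] := leP 0 (Y - z + 1).
    apply: le_trans (count_below_le _ y0) _.
    by have : Y <= Num.max 0 Y by [rewrite le_max; apply/orP; right]; lra.
  rewrite big1 => [|i _].
    have : 0 <= Num.max 0 Y by rewrite le_max; apply/orP; left.
    by have := normr_ge0 z; lra.
  suff -> : (i%:R < Y - z) = false by [].
  by apply/negbTE; rewrite -leNgt; have := ler0n R i; lra.
have : Num.max 0 Y - `|z| <= \sum_(i < 2 * J + 1) '1[i%:R < Y - z].
  by case: (leP 0 Y) => _ //; apply: le_trans S0; have := normr_ge0 z; lra.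
by rewrite ler_norml => ?; apply/andP; split; lra.
Qed.

(** The point in column i - J of row b is, up to the margin z, covered by the
    angular range of the row above.  The row below is treated by the same
    condition on the mirror column. *)
Definition in_overlap (R : realType) (t eta z : R) (J i b : nat) : bool :=
  (eta * J%:R <= b%:R) && (i%:R < 2 * J%:R - t * J%:R ^+ 2 / b%:R - z).

(** For each column the in_overlap rows form an interval ending at J, to which
    equidist applies; summing eta J / b over columns first then gives a Riemann
    sum.  The margin z only changes O(J) terms. *)
Lemma overlap_count (R : realType) (t eta z a A e : R) :
  0 < t -> 0 < eta <= 1 -> 0 < a -> 0 < A -> 0 < e ->
  exists K : R, forall J : nat, K <= J%:R -> forall X : nat -> R,
  (forall i, (i < 2 * J + 1)%N -> a * J%:R ^+ 2 <= `|X i| <= A * J%:R ^+ 2) ->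
  \sum_(i < 2 * J + 1) \sum_(0 <= b < J)
     '1[in_overlap t eta z J i b] * '1[fracp (X i / b%:R) < eta * J%:R / b%:R] <=
   (overlap_loss t eta + e) * J%:R ^+ 2 /\
  (overlap_loss t eta - e) * J%:R ^+ 2 <=
  \sum_(i < 2 * J + 1) \sum_(0 <= b < J)
     '1[in_overlap t eta z J i b] * '1[0 < fracp (X i / b%:R) < eta * J%:R / b%:R].
Proof.
move=> t0 /andP[eta0 eta1] a0 A0 e0.
have e9 : 0 < e / 9 by rewrite divr_gt0.
have e3 : 0 < e / 3 by rewrite divr_gt0.
have [K1 HK1] := equidist a0 A0 eta0 e9.
have [K2 HK2] := overlap_riemann_sum t0 eta0 e3.
pose K3 := 3 * (`|z| + 1) / e.
have K30 : 0 <= K3 by rewrite divr_ge0 ?(ltW e0)// mulr_ge0// addr_ge0.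
exists (1 + `|K1| + `|K2| + K3) => J KJ X HX.
pose W i b := in_overlap t eta z J i b; rewrite -/W.
have n1 := ler_norm K1; have n2 := ler_norm K2.
have m1 := normr_ge0 K1; have m2 := normr_ge0 K2.
have J1 : 1 <= J%:R :> R by lra.
have J0 : 0 < J%:R :> R by lra.
have {}HK1 := HK1 J ltac:(lra); have {}HK2 := HK2 J ltac:(lra).
pose M := \sum_(i < 2 * J + 1) \sum_(0 <= b < J) '1[W i b] * (eta * J%:R / b%:R).
have hM : `|M - J%:R ^+ 2 * overlap_loss t eta| <= 2 * (e / 3) * J%:R ^+ 2.
  set L := J%:R ^+ 2 * _ in HK2 *; set T := \sum_(0 <= b < J) _ in HK2.
  suff hT : `|M - T| <= e / 3 * J%:R ^+ 2.
    have -> : M - L = (M - T) + (T - L) by ring.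
    by apply: le_trans (ler_normD _ _) _; lra.
  have -> : M = \sum_(0 <= b < J) '1[eta * J%:R <= b%:R] * (eta * J%:R / b%:R *
     \sum_(i < 2 * J + 1) '1[i%:R < 2 * J%:R - t * J%:R ^+ 2 / b%:R - z]).
    rewrite /M exchange_big /=; apply: eq_bigr => b _; rewrite /W /in_overlap.
    case: (_ <= b%:R) => /=; last first.
      by rewrite big1 ?mul0r// => i _; rewrite mul0r.
    by rewrite mul1r mulr_sumr; apply: eq_bigr => i _; rewrite mulrC.
  rewrite /T -sumrB; apply: le_trans (ler_norm_sum _ _ _) _.
  apply: (@le_trans _ _ (\sum_(0 <= b < J) (`|z| + 1))).
    apply: ler_sum => b _; have [hb|_] /= := leP (eta * J%:R) b%:R; last first.
      by rewrite !mul0r subrr normr0 addr_ge0.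
    have b0 : 0 < b%:R :> R by rewrite (lt_le_trans _ hb)// mulr_gt0.
    rewrite !mul1r -mulrBr normrM ger0_norm; last first.
      by rewrite divr_ge0 ?(ltW b0)// mulr_ge0 ?(ltW eta0)// ltW.
    rewrite -[leRHS]mul1r; apply: ler_pM => //.
    - by rewrite divr_ge0 ?(ltW b0)// mulr_ge0 ?(ltW eta0)// ltW.
    - by rewrite ler_pdivrMr// mul1r.
    - apply: count_below_dist; rewrite lerBlDr lerDl.
      by rewrite divr_ge0 ?(ltW b0)// mulr_ge0 ?(ltW t0)// exprn_ge0// ltW.
  rewrite sumr_const_nat subn0 -[_ *+ _]mulr_natr expr2 mulrA ler_wpM2r ?(ltW J0)//.
  have : K3 <= J%:R by lra.
  by rewrite /K3 ler_pdivrMr//; lra.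
have err : (2 * J + 1)%:R * (e / 9 * J%:R) <= e / 3 * J%:R ^+ 2.
  rewrite natrD natrM (_ : e / 3 * _ = (3 * J%:R) * (e / 9 * J%:R)); last by field.
  by rewrite ler_wpM2r ?mulr_ge0 ?(ltW J0) ?(ltW e9)//; lra.
have row (i : 'I_(2 * J + 1)) : \sum_(0 <= b < J)
     '1[W i b] * '1[fracp (X i / b%:R) < eta * J%:R / b%:R] <=
     \sum_(0 <= b < J) '1[W i b] * (eta * J%:R / b%:R) + e / 9 * J%:R /\
   \sum_(0 <= b < J) '1[W i b] * (eta * J%:R / b%:R) - e / 9 * J%:R <=
   \sum_(0 <= b < J)
     '1[W i b] * '1[0 < fracp (X i / b%:R) < eta * J%:R / b%:R].
  have [B BJ HB] : exists2 B, (B <= J)%N & forall b, (b < J)%N -> W i b = (B <= b)%N.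
    apply: monotone_threshold => b b' bb' /andP[hb hi].
    have bbR : b%:R <= b'%:R :> R by rewrite ler_nat.
    have b0 : 0 < b%:R :> R by rewrite (lt_le_trans _ hb)// mulr_gt0.
    rewrite /W /in_overlap (le_trans hb)//= (lt_le_trans hi)// lerD2r lerD2l lerN2.
    rewrite ler_wpM2l ?mulr_ge0 ?exprn_ge0 ?(ltW t0) ?(ltW J0)//.
    by rewrite lef_pV2 ?posrE// (lt_le_trans b0).
  have hB : eta * J%:R <= B%:R.
    move: BJ; rewrite leq_eqVlt => /predU1P[->|BJ]; first by rewrite ler_piMl.
    by have := HB B BJ; rewrite leqnn => /andP[].
  rewrite !(sum_threshold _ BJ HB).
  exact: (HK1 (X i) B (HX i (ltn_ord i)) hB BJ).
have csum (c : R) : \sum_(i < 2 * J + 1) c = (2 * J + 1)%:R * c.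
  by rewrite sumr_const card_ord mulr_natl.
move: hM; rewrite ler_norml => /andP[hM1 hM2]; split.
- apply: (@le_trans _ _ (\sum_(i < 2 * J + 1)
    (\sum_(0 <= b < J) '1[W i b] * (eta * J%:R / b%:R) + e / 9 * J%:R))).
    by apply: ler_sum => i _; have [] := row i.
  by rewrite big_split /= csum -/M; lra.
- apply: (@le_trans _ _ (\sum_(i < 2 * J + 1)
    (\sum_(0 <= b < J) '1[W i b] * (eta * J%:R / b%:R) - e / 9 * J%:R))).
    by rewrite sumrB csum -/M; lra.
  by apply: ler_sum => i _; have [] := row i.
Qed.

(** * Gaps of a sorted sequence, and angles *)

(** If the gap after the i-th term is at least g, then no value lies strictly between
    that term and the term plus g. *)
Lemma gap_count_le (R : realType) (l : seq R) (g : R) :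
  (count (fun j => g <= nth 0%R (sort <=%R l) j - nth 0%R (sort <=%R l) j.-1)%R
     (index_iota 1 (size l))
   <= count (fun x => ~~ has (fun y => x < y < x + g)%R l) l)%N.
Proof.
set s := sort _ l; set P := (X in (_ <= count X l)%N).
have sl : perm_eq s l by rewrite perm_sort.
have sz : size s = size l by rewrite size_sort.
have srt : sorted <=%R s by apply: sort_le_sorted.
have cs (p : pred R) : count p s = count (fun i => p (nth 0%R s i)) (iota 0 (size s)).
  by rewrite -{1}(mkseq_nth 0 s) /mkseq count_map.
rewrite -(permP sl P) -sz cs.
case E : (size s) => [|n] //.
rewrite /index_iota subSS subn0 -[n.+1]addn1 iotaD count_cat.
rewrite (_ : iota 1 n = map S (iota 0 n)); last by rewrite -(iotaDl 1).
rewrite count_map; apply: leq_trans (leq_addr _ _).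
rewrite -!size_filter; apply: uniq_leq_size; first by rewrite filter_uniq ?iota_uniq.
move=> i; rewrite !mem_filter mem_iota add0n => /andP[/= gi ilt].
rewrite ilt andbT /P; apply/hasPn => y.
rewrite -(perm_mem sl) => /(nthP 0)[k ks <-]; rewrite E in ks.
apply/negP => /andP[h1 h2].
have [ki|ik] := leqP k i.
  have : nth 0 s k <= nth 0 s i.
    by apply: (sorted_leq_nth le_trans le_refl 0 srt); rewrite ?inE ?E// ltnW.
  by rewrite leNgt h1.
have : nth 0 s i.+1 <= nth 0 s k.
  by apply: (sorted_leq_nth le_trans le_refl 0 srt); rewrite ?inE ?E// ltnS.
by lra.
Qed.

(** Here ties count against the term, so that a term which is alone in its window
    and is not the last one is followed by a gap at least g. *)
Lemma gap_count_ge (R : realType) (l : seq R) (g : R) :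
  (count (fun x => (count (fun y => x <= y < x + g)%R l <= 1)%N) l <=
   (count (fun j => g <= nth 0%R (sort <=%R l) j - nth 0%R (sort <=%R l) j.-1)%R
     (index_iota 1 (size l))).+1)%N.
Proof.
set s := sort _ l; set Q := (X in (count X l <= _)%N).
have sl : perm_eq s l by rewrite perm_sort.
have sz : size s = size l by rewrite size_sort.
have srt : sorted <=%R s by apply: sort_le_sorted.
have cs (p : pred R) : count p s = count (fun i => p (nth 0%R s i)) (iota 0 (size s)).
  by rewrite -{1}(mkseq_nth 0 s) /mkseq count_map.
rewrite -(permP sl Q) -sz cs.
case E : (size s) => [|n] //.
rewrite /index_iota subSS subn0 -[n.+1]addn1 iotaD count_cat /= addn0 -[leqRHS]addn1.
rewrite leq_add ?leq_b1//.
rewrite (_ : iota 1 n = map S (iota 0 n)); last by rewrite -(iotaDl 1).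
rewrite count_map -!size_filter; apply: uniq_leq_size; first by rewrite filter_uniq ?iota_uniq.
move=> i; rewrite !mem_filter mem_iota add0n => /andP[/= Qi ilt].
rewrite ilt andbT /=.
have ii : nth 0 s i <= nth 0 s i.+1.
  by apply: (sorted_leq_nth le_trans le_refl 0 srt); rewrite ?inE ?E// ltnS ltnW.
rewrite leNgt; apply/negP => gi; move: Qi.
have sE (p : pred R) : count p s = (count p (take i s) +
    (p (nth 0%R s i) + (p (nth 0%R s i.+1) + count p (drop i.+2 s))))%N.
  rewrite -{1}(cat_take_drop i s) count_cat (drop_nth 0) ?E 1?ltnS 1?ltnW//=.
  by rewrite (drop_nth 0) ?E ?ltnS.
rewrite /Q -(permP sl) sE.
have -> : nth 0 s i <= nth 0 s i < nth 0 s i + g by rewrite lexx /=; lra.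
have -> : nth 0 s i <= nth 0 s i.+1 < nth 0 s i + g by rewrite ii /=; lra.
by rewrite /= addnCA add1n ltnS leqn0 !addn_eq0 andbF.
Qed.

Lemma atan_sub_bounds (R : realType) (x y : R) : 0 <= x <= y ->
  (y - x) / (1 + y ^+ 2) <= atan y - atan x <= y - x.
Proof.
case/andP => x0 xy.
have pos (u : R) : 0 < 1 + u ^+ 2 by rewrite ltr_pwDl// sqr_ge0.
have der u : u \in `]x, y[%R -> is_derive u 1 (@atan R) (1 + u ^+ 2)^-1.
  by move=> *; exact: is_derive1_atan.
have cont : {within `[x, y], continuous (@atan R)}.
  by apply: continuous_subspaceT => u; exact: continuous_atan.
have [u] := MVT_segment xy der cont.
rewrite in_itv /= => /andP[xu uy] ->.
have u0 : 0 <= u by apply: le_trans xu.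
have uy2 : u ^+ 2 <= y ^+ 2 by rewrite lerXn2r ?nnegrE// (le_trans u0).
rewrite mulrC; apply/andP; split.
  rewrite ler_wpM2r ?subr_ge0// lef_pV2 ?posrE// lerD2l//.
by rewrite ler_piMl ?subr_ge0// invf_le1// lerDl sqr_ge0.
Qed.

Lemma angle_from_axis (R : realType) (a b d : R) : 0 < d -> 0 < d + a -> 0 <= b ->
  angle (a, b) (- d, 0) (0, 0) = atan (b / (d + a)).
Proof.
move=> d0 c0 b0; rewrite /angle /enorm /dotp /= !opprK !add0r !subr0 !oppr0 !mulr0 !addr0.
rewrite [a + d]addrC; set c := d + a in c0 *.
have n0 : 0 < Num.sqrt (c * c + b * b).
  by rewrite sqrtr_gt0 ltr_pwDl ?mulr_gt0// mulr_ge0.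
rewrite -(expr2 d) sqrtr_sqr gtr0_norm//.
rewrite (_ : c * d / _ = c / Num.sqrt (c * c + b * b)); last first.
  by field; rewrite !lt0r_neq0.
have bc0 : 0 <= b / c by rewrite divr_ge0// ltW.
have -> : c / Num.sqrt (c * c + b * b) = cos (atan (b / c)).
  rewrite cos_atan.
  have sE : Num.sqrt (c * c + b * b) = c * Num.sqrt (1 + (b / c) ^+ 2).
    rewrite -{3}[c]gtr0_norm// -sqrtr_sqr -sqrtrM ?sqr_ge0//.
    by congr Num.sqrt; field; rewrite lt0r_neq0.
  have : 0 < Num.sqrt (1 + (b / c) ^+ 2) by rewrite sqrtr_gt0 ltr_pwDl// sqr_ge0.
  by rewrite sE; move: (Num.sqrt (1 + _)) => r r0; field; rewrite !lt0r_neq0.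
rewrite cosK// in_itv /=; apply/andP; split.
  by rewrite -atan0 le_atan.
by have := atan_ltpi2 (b / c); have := pi_gt0 R; lra.
Qed.

(** * Angular proximity as an integral condition *)

Definition point_angle (R : realType) (t : R) (J : nat) (p : int * int) : R :=
  angle (p.1%:~R, p.2%:~R) (viewpoint t J) (0, 0).

Definition abscissa (R : realType) (t : R) (J : nat) (p : int * int) : R :=
  t * J%:R ^+ 2 + p.1%:~R.

(** The numerator of the difference of the slopes of q and p. *)
Definition cross (R : realType) (t : R) (J : nat) (p q : int * int) : R :=
  q.2%:~R * abscissa t J p - p.2%:~R * abscissa t J q.

Lemma box_bounds (R : realType) (J : nat) (p : int * int) : p \in lattice_box J ->
  [/\ - J%:R <= p.1%:~R :> R, p.1%:~R <= J%:R :> R, 0 <= p.2%:~R :> R & p.2%:~R <= J%:R :> R].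
Proof.
rewrite mem_lattice_box => /andP[/andP[h1 h2] /andP[h3 h4]].
have e : J%:R = (J%:Z)%:~R :> R by [].
by split; rewrite ?e -?intrN ?ler_int// (ler_int _ 0).
Qed.

Lemma point_angleE (R : realType) (t : R) (J : nat) (p : int * int) :
  0 < t -> 1 < t * J%:R -> p \in lattice_box J ->
  point_angle t J p = atan (p.2%:~R / abscissa t J p).
Proof.
move=> t0 tJ pJ; have [h1 h2 h3 h4] := box_bounds R pJ.
have J0 : 0 < J%:R :> R by rewrite -(pmulr_rgt0 _ t0); lra.
rewrite /point_angle /viewpoint angle_from_axis// ?mulr_gt0 ?exprn_gt0//.
have : 1 * J%:R < t * J%:R * J%:R by rewrite ltr_pM2r.
by rewrite expr2 mulrA; lra.
Qed.

Lemma abscissa_bounds (R : realType) (t : R) (J : nat) (p : int * int) :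
  p \in lattice_box J ->
  J%:R * (t * J%:R - 1) <= abscissa t J p <= J%:R * (t * J%:R + 1).
Proof.
move=> pJ; have [h1 h2 _ _] := box_bounds R pJ.
by rewrite /abscissa expr2; apply/andP; split; lra.
Qed.

(** The largest angle is that of the corner (-J, J). *)
Lemma alpha_maxE (R : realType) (t : R) (J : nat) : 0 < t -> 1 < t * J%:R ->
  alpha t J (box_card J) = atan ((t * J%:R - 1)^-1).
Proof.
move=> t0 tJ.
have J0 : 0 < J%:R :> R by rewrite -(pmulr_rgt0 _ t0); lra.
have tJ1 : 0 < t * J%:R - 1 by lra.
set s := sorted_angles t J.
have sz : size s = box_card J by rewrite size_sort size_map size_lattice_box.
have N0 : (0 < box_card J)%N by rewrite muln_gt0 !addn1.
have srt : sorted <=%R s by apply: sort_le_sorted.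
have mems x : (x \in s) = (x \in [seq point_angle t J p | p <- lattice_box J]).
  exact: mem_sort.
have pmE : (- J%:Z, J%:Z) \in lattice_box J by rewrite mem_lattice_box /=; lia.
have fE : point_angle t J (- J%:Z, J%:Z) = atan ((t * J%:R - 1)^-1).
  rewrite point_angleE// /abscissa /= intrN -pmulrn; congr atan.
  by field; rewrite !lt0r_neq0// expr2; have := mulr_gt0 J0 tJ1; lra.
apply/eqP; rewrite eq_le; apply/andP; split.
  have : alpha t J (box_card J) \in s by rewrite mem_nth// sz prednK.
  rewrite mems => /mapP[p pJ ->]; rewrite point_angleE//; apply: le_atan.
  have [h1 h2 h3 h4] := box_bounds R pJ.
  have /andP[c1 _] := abscissa_bounds t pJ.
  have c0 := lt_le_trans (mulr_gt0 J0 tJ1) c1.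
  rewrite ler_pdivrMr// mulrC ler_pdivlMr//; apply: le_trans c1.
  by rewrite ler_wpM2r// ltW.
rewrite -fE; have : point_angle t J (- J%:Z, J%:Z) \in s by rewrite mems map_f.
move=> /(nthP 0)[k ks <-].
have kN : (k <= (box_card J).-1)%N by rewrite -ltnS prednK// -sz.
by apply: (sorted_leq_nth le_trans le_refl 0 srt); rewrite // inE sz prednK.
Qed.

Lemma average_gap_bounds (R : realType) (t : R) (J : nat) : 0 < t -> 1 < t * J%:R ->
  (t * J%:R - 1)^-1 / (1 + (t * J%:R - 1)^-1 ^+ 2) / (box_card J)%:R <=
    average_gap t J <= (t * J%:R - 1)^-1 / (box_card J)%:R.
Proof.
move=> t0 tJ; rewrite /average_gap alpha_maxE//; set y := (_ - 1)^-1.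
have y0 : (0 : R) <= (0 : R) <= y by apply/andP; split=> //; rewrite /y invr_ge0; lra.
have := atan_sub_bounds y0; rewrite atan0 !subr0 => /andP[h1 h2].
by rewrite !ler_wpM2r ?invr_ge0.
Qed.

Lemma slope_sub (R : realType) (t : R) (J : nat) (p q : int * int) :
  0 < abscissa t J p -> 0 < abscissa t J q ->
  q.2%:~R / abscissa t J q - p.2%:~R / abscissa t J p =
  cross t J p q / (abscissa t J p * abscissa t J q).
Proof.
by rewrite /cross => p0 q0; field; rewrite !lt0r_neq0.
Qed.

Lemma box_cardR (R : realType) (J : nat) :
  (box_card J)%:R = (2 * J%:R + 1) * (J%:R + 1) :> R.
Proof. by rewrite /box_card !addn1 natrM -(natr1 (2 * J)) -(natr1 J) natrM. Qed.

(** With c, c' >= J (t J - 1), a cross product below eta J bounds the difference of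
    angles by eta / (J (t J - 1)^2), while lambda average gaps are about
    lambda / (2 t J^3). *)
Lemma close_of_cross (R : realType) (t eta lambda : R) :
  1 < t -> 0 < eta -> eta < lambda * t / 2 ->
  exists K : R, forall J : nat, K <= J%:R -> forall p q : int * int,
  p \in lattice_box J -> q \in lattice_box J -> 0 < cross t J p q < eta * J%:R ->
  point_angle t J p < point_angle t J q < point_angle t J p + lambda * average_gap t J.
Proof.
move=> t1 eta0 etal.
have t0 : 0 < t by lra.
have l0 : 0 < lambda by rewrite -(pmulr_lgt0 _ t0); lra.
pose d := lambda * t - 2 * eta; have d0 : 0 < d by rewrite /d; lra.
pose k1 := (t - 1)^-1; pose k2 := (lambda + 10 * eta) / d.
have k10 : 0 <= k1 by rewrite invr_ge0; lra.
have k20 : 0 <= k2 by rewrite divr_ge0 ?(ltW d0)//; lra.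
exists (1 + k1 + k2) => J KJ p q pJ qJ /andP[D0 Dh].
have J1 : 1 <= J%:R :> R by lra.
have J0 : 0 < J%:R :> R by lra.
have w1 : J%:R <= t * J%:R - 1.
  have : k1 <= J%:R by lra.
  by rewrite /k1 -[_^-1]div1r ler_pdivrMr; lra.
have w2 : lambda + 10 * eta <= d * J%:R.
  have : k2 <= J%:R by lra.
  by rewrite /k2 ler_pdivrMr// [J%:R * d]mulrC.
have tJ : 1 < t * J%:R by lra.
set w := t * J%:R - 1 in w1.
have w0 : 0 < w by lra.
have /andP[cp _] := abscissa_bounds t pJ; have /andP[cq _] := abscissa_bounds t qJ.
rewrite -/w in cp cq.
have Jw0 : 0 < J%:R * w by rewrite mulr_gt0.
have cp0 := lt_le_trans Jw0 cp; have cq0 := lt_le_trans Jw0 cq.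
have [_ _ bp _] := box_bounds R pJ.
rewrite !point_angleE//.
have sl := slope_sub cp0 cq0.
have sl0 : 0 < cross t J p q / (abscissa t J p * abscissa t J q).
  by rewrite divr_gt0 ?mulr_gt0.
apply/andP; split; first by apply: lt_atan; lra.
have xy : 0 <= p.2%:~R / abscissa t J p <= q.2%:~R / abscissa t J q.
  by rewrite divr_ge0 ?(ltW cp0)//=; lra.
have /andP[_ ub] := atan_sub_bounds xy.
have /andP[avg _] := average_gap_bounds t0 tJ.
rewrite -/w in avg.
rewrite -ltrBlDl (le_lt_trans ub)// sl (lt_le_trans _ (ler_wpM2l (ltW l0) avg))//.
apply: (@lt_le_trans _ _ (eta * J%:R / (J%:R * w) ^+ 2)).
  rewrite ltr_pdivrMr ?mulr_gt0// mulrAC ltr_pdivlMr ?exprn_gt0//.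
  apply: (@lt_le_trans _ _ (eta * J%:R * (J%:R * w) ^+ 2)).
    by rewrite ltr_pM2r ?exprn_gt0.
  by rewrite ler_wpM2l ?mulr_ge0 ?(ltW eta0) ?(ltW J0)// expr2 ler_pM ?(ltW Jw0).
rewrite box_cardR.
have -> : lambda * (w^-1 / (1 + w^-1 ^+ 2) / ((2 * J%:R + 1) * (J%:R + 1))) =
   lambda * w / ((w ^+ 2 + 1) * ((2 * J%:R + 1) * (J%:R + 1))).
  field; rewrite !lt0r_neq0// ?ltr_pwDl ?exprn_gt0 ?mulr_gt0 ?exprn_ge0//; lra.
rewrite ler_pdivrMr ?exprn_gt0// mulrAC ler_pdivlMr; last first.
  by rewrite !mulr_gt0 ?ltr_pwDr ?exprn_ge0 ?(ltW w0)//; lra.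
have P2 : J%:R ^+ 2 * (w ^+ 2 + 1) <= w ^+ 2 * (J%:R ^+ 2 + 1).
  have : J%:R ^+ 2 <= w ^+ 2 by rewrite lerXn2r ?nnegrE ?(ltW J0) ?(ltW w0).
  by rewrite !mulrDr !mulr1 [w ^+ 2 * _]mulrC; lra.
have N0 : 0 <= eta * ((2 * J%:R + 1) * (J%:R + 1)).
  by rewrite !mulr_ge0 ?(ltW eta0)//; lra.
have P1 : (J%:R ^+ 2 + 1) * (eta * ((2 * J%:R + 1) * (J%:R + 1))) <= lambda * w * J%:R ^+ 3.
  have p3 : 0 <= J%:R ^+ 3 :> R by rewrite exprn_ge0// ltW.
  have e3 : J%:R ^+ 2 <= J%:R ^+ 3 :> R by rewrite ler_weXn2l.
  have e2 : J%:R <= J%:R ^+ 3 :> R by rewrite -[leLHS]expr1 ler_weXn2l.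
  have e1 : 1 <= J%:R ^+ 3 :> R by rewrite exprn_ege1.
  have := ler_wpM2r p3 w2; rewrite /d => h.
  have hq : eta * (3 * J%:R ^+ 3 + 3 * J%:R ^+ 2 + 3 * J%:R + 1) <= eta * (10 * J%:R ^+ 3).
    by rewrite ler_pM2l//; lra.
  by rewrite /w; move: h hq; set x := J%:R => h hq; nra.
rewrite -(ler_pM2l J0).
apply: (@le_trans _ _ (w ^+ 2 * (J%:R ^+ 2 + 1) * (eta * ((2 * J%:R + 1) * (J%:R + 1))))).
  apply: le_trans (ler_wpM2r N0 P2).
  by rewrite le_eqVlt; apply/orP; left; apply/eqP; ring.
rewrite -mulrA; apply: le_trans (ler_wpM2l (sqr_ge0 w) P1) _.
by rewrite le_eqVlt; apply/orP; left; apply/eqP; ring.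
Qed.

(** The reverse comparison, with c, c' <= J (t J + 1) and the derivative of atan
    bounded from below on the range of slopes. *)
Lemma cross_of_close (R : realType) (t eta lambda : R) :
  1 < t -> 0 <= lambda -> lambda * t / 2 < eta ->
  exists K : R, forall J : nat, K <= J%:R -> forall p q : int * int,
  p \in lattice_box J -> q \in lattice_box J ->
  point_angle t J p <= point_angle t J q < point_angle t J p + lambda * average_gap t J ->
  0 <= cross t J p q < eta * J%:R.
Proof.
move=> t1 l0 etal.
have t0 : 0 < t by lra.
have eta0 : 0 < eta by have := mulr_ge0 l0 (ltW t0); lra.
pose d := t * (2 * eta - lambda * t); have d0 : 0 < d by rewrite /d mulr_gt0//; lra.
pose c := lambda * (t ^+ 2 + 4 * t + 2) + 2 * eta.
have c0 : 0 <= c.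
  by rewrite addr_ge0 ?mulr_ge0 ?addr_ge0 ?exprn_ge0 ?mulr_ge0 ?(ltW t0) ?(ltW eta0).
pose k1 := (t - 1)^-1; pose k2 := c / d.
have k10 : 0 <= k1 by rewrite invr_ge0; lra.
have k20 : 0 <= k2 by rewrite divr_ge0 ?(ltW d0).
exists (1 + k1 + k2) => J KJ p q pJ qJ /andP[fpq fqp].
have J1 : 1 <= J%:R :> R by lra.
have J0 : 0 < J%:R :> R by lra.
have w1 : J%:R <= t * J%:R - 1.
  have : k1 <= J%:R by lra.
  by rewrite /k1 -[_^-1]div1r ler_pdivrMr; lra.
have w2 : c <= d * J%:R.
  have : k2 <= J%:R by lra.
  by rewrite /k2 ler_pdivrMr// [J%:R * d]mulrC.
have tJ : 1 < t * J%:R by lra.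
set w := t * J%:R - 1 in w1.
have w0 : 0 < w by lra.
have /andP[cp cp'] := abscissa_bounds t pJ; have /andP[cq cq'] := abscissa_bounds t qJ.
rewrite -/w in cp cq.
have Jw0 : 0 < J%:R * w by rewrite mulr_gt0.
have cp0 := lt_le_trans Jw0 cp; have cq0 := lt_le_trans Jw0 cq.
have [_ _ bp _] := box_bounds R pJ; have [_ _ bq bqJ] := box_bounds R qJ.
move: fpq fqp; rewrite !point_angleE// => fpq fqp.
have sl := slope_sub cp0 cq0.
have D0 : 0 <= cross t J p q.
  rewrite leNgt; apply/negP => D0; move: fpq; rewrite leNgt lt_atan//.
  have : cross t J p q / (abscissa t J p * abscissa t J q) < 0.
    by rewrite pmulr_llt0 ?invr_gt0 ?mulr_gt0.
  by lra.
rewrite D0 /= ltNge; apply/negP => Dh; move: fqp; rewrite ltNge => /negP; apply.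
have sl0 : 0 <= cross t J p q / (abscissa t J p * abscissa t J q).
  by rewrite divr_ge0// mulr_ge0 ?(ltW cp0) ?(ltW cq0).
have xy : 0 <= p.2%:~R / abscissa t J p <= q.2%:~R / abscissa t J q.
  by rewrite divr_ge0 ?(ltW cp0)//=; lra.
have /andP[lb _] := atan_sub_bounds xy.
have /andP[_ avg] := average_gap_bounds t0 tJ.
rewrite -/w in avg.
rewrite -lerBrDl (le_trans _ lb)// sl (le_trans (ler_wpM2l l0 avg))//.
set y := q.2%:~R / abscissa t J q in xy *.
have y0 : 0 <= y by rewrite divr_ge0 ?(ltW cq0).
have yw : y <= w^-1.
  rewrite /y ler_pdivrMr// mulrC ler_pdivlMr// (le_trans _ cq)//.
  by rewrite ler_wpM2r// ltW.
pose v := t * J%:R + 1; have v0 : 0 < v by rewrite /v; lra.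
apply: (@le_trans _ _ (eta * J%:R / (J%:R * v) ^+ 2 / (1 + w^-1 ^+ 2))); last first.
  apply: ler_pM.
  - by rewrite divr_ge0 ?exprn_ge0 ?mulr_ge0 ?(ltW eta0) ?(ltW J0) ?(ltW v0).
  - by rewrite invr_ge0 addr_ge0// sqr_ge0.
  - apply: ler_pM => //; first by rewrite mulr_ge0 ?(ltW eta0).
      by rewrite invr_ge0 exprn_ge0// mulr_ge0 ?(ltW v0).
    by rewrite lef_pV2 ?posrE ?exprn_gt0 ?mulr_gt0// expr2 ler_pM ?(ltW cp0) ?(ltW cq0).
  - rewrite lef_pV2 ?posrE ?ltr_pwDl ?sqr_ge0// lerD2l lerXn2r ?nnegrE// invr_ge0.
    exact: ltW.
have w21 : 0 < w ^+ 2 + 1 by rewrite ltr_pwDr// exprn_ge0// ltW.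
have N0 : 0 < (2 * J%:R + 1) * (J%:R + 1) :> R by rewrite mulr_gt0//; lra.
have -> : eta * J%:R / (J%:R * v) ^+ 2 / (1 + w^-1 ^+ 2) =
   eta * w ^+ 2 / (J%:R * v ^+ 2 * (w ^+ 2 + 1)).
  rewrite (_ : 1 + w^-1 ^+ 2 = (w ^+ 2 + 1) / w ^+ 2); last by field; rewrite lt0r_neq0.
  by move: (w ^+ 2 + 1) w21 => u u0; field; rewrite !lt0r_neq0.
have [N NE] : exists N, N = (2 * J%:R + 1) * (J%:R + 1) :> R by eexists.
rewrite box_cardR -NE in N0 *.
rewrite (mulrA lambda) ler_pdivrMr// mulrAC ler_pdivlMr ?mulr_gt0 ?exprn_gt0//.
rewrite -(ler_pM2l w0).
rewrite (_ : w * (lambda / w * _) = lambda * (J%:R * v ^+ 2 * (w ^+ 2 + 1))); last first.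
  by field; rewrite lt0r_neq0.
have P2 : J%:R ^+ 2 * (w ^+ 2 + 1) <= w ^+ 2 * (J%:R ^+ 2 + 1).
  have : J%:R ^+ 2 <= w ^+ 2 by rewrite lerXn2r ?nnegrE ?(ltW J0) ?(ltW w0).
  by rewrite !mulrDr !mulr1 [w ^+ 2 * _]mulrC; lra.
have P1 : lambda * v ^+ 2 * (J%:R ^+ 2 + 1) <= eta * w * N * J%:R.
  have p3 : 0 <= J%:R ^+ 3 :> R by rewrite exprn_ge0// ltW.
  have e3 : J%:R ^+ 2 <= J%:R ^+ 3 :> R by rewrite ler_weXn2l.
  have e2 : J%:R <= J%:R ^+ 3 :> R by rewrite -[leLHS]expr1 ler_weXn2l.
  have e1 : 1 <= J%:R ^+ 3 :> R by rewrite exprn_ege1.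
  have h := ler_wpM2r p3 w2; rewrite /d /c in h.
  have h1 : lambda * ((1 + t ^+ 2) * J%:R ^+ 2 + 2 * t * J%:R + 1) <=
            lambda * ((1 + t ^+ 2) * J%:R ^+ 3 + 2 * t * J%:R ^+ 3 + J%:R ^+ 3).
    rewrite ler_wpM2l// lerD// lerD// ler_wpM2l//.
      by rewrite addr_ge0// sqr_ge0.
    by rewrite mulr_ge0// ltW.
  have h2 : eta * (3 * J%:R ^+ 2 + J%:R) <= eta * (3 * t * J%:R ^+ 3 + t * J%:R ^+ 2).
    rewrite ler_pM2l//; have := ler_wpM2r p3 (ltW t1).
    by have := ler_wpM2r (exprn_ge0 2 (ltW J0)) (ltW t1); lra.
  rewrite NE /w /v; move: h h1 h2; set x := J%:R => h h1 h2; nra.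
rewrite -(ler_pM2l (exprn_gt0 2 J0)).
have Jv0 : 0 <= lambda * J%:R * v ^+ 2.
  by rewrite mulr_ge0 ?exprn_ge0 ?(ltW v0)// mulr_ge0// ltW.
have Jw20 : 0 <= J%:R * w ^+ 2 by rewrite mulr_ge0 ?exprn_ge0 ?(ltW w0)// ltW.
have q1 := ler_wpM2l Jv0 P2; have q2 := ler_wpM2l Jw20 P1.
have -> : J%:R ^+ 2 * (lambda * (J%:R * v ^+ 2 * (w ^+ 2 + 1))) =
  lambda * J%:R * v ^+ 2 * (J%:R ^+ 2 * (w ^+ 2 + 1)) by ring.
apply: (le_trans q1).
have -> : lambda * J%:R * v ^+ 2 * (w ^+ 2 * (J%:R ^+ 2 + 1)) =
  J%:R * w ^+ 2 * (lambda * v ^+ 2 * (J%:R ^+ 2 + 1)) by ring.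
by apply: (le_trans q2); rewrite le_eqVlt; apply/orP; left; apply/eqP; ring.
Qed.

(** * Neighbours of a point in the adjacent rows *)

Lemma in_box (R : realType) (J : nat) (p : int * int) :
  - J%:R <= p.1%:~R :> R -> p.1%:~R <= J%:R :> R -> 0 <= p.2%:~R :> R ->
  p.2%:~R <= J%:R :> R -> p \in lattice_box J.
Proof.
have e : J%:R = (J%:Z)%:~R :> R by [].
rewrite mem_lattice_box !e -intrN !ler_int (ler_int _ 0).
by move=> -> -> -> ->.
Qed.

Lemma count_box (R : realType) (J : nat) (P : pred (int * int)) :
  (count P (lattice_box J))%:R =
  \sum_(i < 2 * J + 1) \sum_(0 <= b < J + 1) '1[P (i%:Z - J%:Z, b%:Z)] :> R.
Proof.
have io n : iota 0 n = index_iota 0 n by rewrite /index_iota subn0.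
rewrite -sum1_count big_mkcond natr_sum big_allpairs_dep /= !io big_mkord.
by apply: eq_bigr => i _; apply: eq_bigr => b _; case: (P _).
Qed.

(** These are k c for k = 1 and k = -1, the second one as a function of the mirror
    column, so that both rows adjacent to p lead to the same in_overlap condition. *)
Definition abscissa_up (R : realType) (t : R) (J i : nat) : R :=
  t * J%:R ^+ 2 + (i%:R - J%:R).

Definition abscissa_down (R : realType) (t : R) (J i : nat) : R :=
  - (t * J%:R ^+ 2 + (J%:R - i%:R)).

Lemma cross_neighbour (R : realType) (t : R) (J : nat) (p : int * int) (k d : int) :
  cross t J p (p.1 + d, p.2 + k) = k%:~R * abscissa t J p - p.2%:~R * d%:~R.
Proof. by rewrite /cross /abscissa /= !intrD; ring. Qed.

Definition gap_above (R : realType) (t g : R) (J : nat) (p : int * int) : bool :=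
  ~~ has (fun q => point_angle t J p < point_angle t J q < point_angle t J p + g)
    (lattice_box J).

Definition isolated (R : realType) (t g : R) (J : nat) (p : int * int) : bool :=
  (count (fun q => (point_angle t J p <= point_angle t J q < point_angle t J p + g)%R)
     (lattice_box J) <= 1)%N.

Definition mirror (J i : nat) : nat := (2 * J + 1 - i.+1)%N.

Lemma left_in_box (J i b : nat) : (0 < i <= 2 * J)%N -> (b <= J)%N ->
  (i%:Z - J%:Z + -1, b%:Z + 0) \in lattice_box J.
Proof. by rewrite mem_lattice_box /=; lia. Qed.

Lemma upper_row_in_box (R : realType) (J i b : nat) (f : int) (T s z : R) :
  (b < J)%N -> 0 <= f -> f%:~R <= T + s -> s <= z -> i%:R < 2 * J%:R - T - z ->
  (i%:Z - J%:Z + f, b%:Z + 1) \in lattice_box J.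
Proof.
move=> bJ f0 fT sz iT; rewrite mem_lattice_box /=.
suff : i%:Z + f <= 2 * J%:Z by lia.
by rewrite -(ler_int R) intrD intrM -!pmulrn; lra.
Qed.

Lemma lower_row_in_box (R : realType) (J i b : nat) (f : int) (T s z : R) :
  (i <= 2 * J)%N -> (0 < b <= J)%N -> f <= 0 -> - (T + s) < f%:~R + 1 -> s + 1 <= z ->
  2 * J%:R - i%:R < 2 * J%:R - T - z ->
  (i%:Z - J%:Z + f, b%:Z + -1) \in lattice_box J.
Proof.
move=> iJ bJ f0 fT sz iT; rewrite mem_lattice_box /=.
suff : 0 <= i%:Z + f by lia.
by rewrite -(ler_int R) intrD -!pmulrn; lra.
Qed.

(** The corrections for i = 0 and b = 0 take care of the points which have no
    left neighbour, or whose row is seen at angle 0.  The margin in z ensures that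
    the candidate of the adjacent row is inside the box. *)
Lemma gap_above_le (R : realType) (t eta z g : R) (J i b : nat) :
  1 < t -> 0 < eta -> 1 < t * J%:R -> z = eta^-1 + 2 ->
  (forall p q, p \in lattice_box J -> q \in lattice_box J ->
     0 < cross t J p q < eta * J%:R ->
     point_angle t J p < point_angle t J q < point_angle t J p + g) ->
  (i < 2 * J + 1)%N -> (b < J)%N ->
  '1[gap_above t g J (i%:Z - J%:Z, b%:Z)] <=
  '1[(i == 0)%N] + '1[(b == 0)%N] + '1[eta * J%:R <= b%:R]
  - '1[in_overlap t eta z J i b] *
    '1[0 < fracp (abscissa_up t J i / b%:R) < eta * J%:R / b%:R]
  - '1[in_overlap t eta z J (mirror J i) b] *
    '1[0 < fracp (abscissa_down t J (mirror J i) / b%:R) < eta * J%:R / b%:R] :> R.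
Proof.
move=> t1 eta0 tJ zE close iJ bJ; set i' := mirror J i.
have J0 : 0 < J%:R :> R by rewrite ltr0n (leq_ltn_trans (leq0n b) bJ).
have iJ' : (i <= 2 * J)%N by move: iJ; rewrite addn1.
have iJR : i%:R <= 2 * J%:R :> R by rewrite -natrM ler_nat.
have i'E : i'%:R = 2 * J%:R - i%:R :> R.
  by rewrite /i' /mirror addn1 subSS natrB ?natrM.
have bJR : b.+1%:R <= J%:R :> R by rewrite ler_nat.
rewrite -natr1 in bJR.
have i0R := ler0n R i; have b0R := ler0n R b.
have eta' : 0 < eta^-1 by rewrite invr_gt0.
set p := (i%:Z - J%:Z, b%:Z).
have p1 : p.1%:~R = i%:R - J%:R :> R by rewrite /p /= intrB -!pmulrn.
have p2 : p.2%:~R = b%:R :> R by [].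
have pJ : p \in lattice_box J.
  by apply: (@in_box R); rewrite ?p1 ?p2; lra.
have cE : abscissa t J p = abscissa_up t J i by rewrite /abscissa p1.
have cE' : abscissa_down t J i' = - abscissa t J p.
  by rewrite /abscissa_down i'E /abscissa p1; congr (- _); ring.
have c0 : 0 < abscissa t J p.
  have /andP[h _] := abscissa_bounds t pJ; apply: lt_le_trans h.
  by rewrite mulr_gt0//; lra.
set e1 := in_overlap t eta z J i b; set e2 := in_overlap t eta z J i' b.
set f1 := 0 < fracp _ < _; set f2 := 0 < fracp _ < _.
have e12 : ~~ (e1 && e2).
  apply/negP => /andP[/andP[hb h1] /andP[_ h2]].
  have b0 : 0 < b%:R :> R by rewrite (lt_le_trans _ hb)// mulr_gt0.
  rewrite i'E in h2.
  have : t * J%:R <= t * J%:R ^+ 2 / b%:R.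
    rewrite ler_pdivlMr// expr2 mulrA ler_pM2l ?mulr_gt0//; lra.
  have : 1 * J%:R < t * J%:R by rewrite ltr_pM2r.
  by lra.
have e1h : e1 -> eta * J%:R <= b%:R by case/andP.
have e2h : e2 -> eta * J%:R <= b%:R by case/andP.
have base : 0 <= '1[eta * J%:R <= b%:R] - '1[e1] * '1[f1] - '1[e2] * '1[f2] :> R.
  case: e1 e2 e12 e1h e2h => [] [] // _ h1 h2; rewrite ?(h1 isT) ?(h2 isT) ?mul1r ?mul0r.
  - by rewrite subr0 subr_ge0 lern1 leq_b1.
  - by rewrite subr0 subr_ge0 lern1 leq_b1.
  - by rewrite !subr0.
have [/hasPn noq|_] := boolP (gap_above _ _ _ _); last first.
  by rewrite /=; have := ler0n R (i == 0)%N; have := ler0n R (b == 0)%N; lra.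
have [_|i0] := boolP (i == 0)%N.
  by rewrite /=; have := ler0n R (b == 0)%N; lra.
have [_|b0] := boolP (b == 0)%N.
  by rewrite /=; have := ler0n R (i == 0)%N; lra.
have noQ q : q \in lattice_box J -> 0 < cross t J p q < eta * J%:R -> False.
  by move=> qJ /(close _ _ pJ qJ); apply/negP/noq.
have b0' : 0 < b%:R :> R by rewrite ltr0n lt0n.
have b1 : 1 <= b%:R :> R by rewrite ler1n lt0n.
have i1 : 1 <= i%:R :> R by rewrite ler1n lt0n.
have hb : eta * J%:R <= b%:R.
  rewrite leNgt; apply/negP => bh; apply: (noQ (p.1 + -1, p.2 + 0)).
    by apply: left_in_box; [rewrite lt0n i0|apply: ltnW].
  by rewrite cross_neighbour mul0r sub0r intrN mulrN mulr1 opprK; apply/andP.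
(* With this floor, the cross product is the least nonnegative value that row
   b + k can give. *)
have nbr (k : int) (f := Num.floor (k%:~R * abscissa t J p / b%:R)) :
    (p.1 + f, p.2 + k) \in lattice_box J ->
    ~~ (0 < fracp (k%:~R * abscissa t J p / b%:R) < eta * J%:R / b%:R).
  move=> qJ; apply/negP => /andP[h1 h2]; apply: (noQ _ qJ).
  rewrite cross_neighbour p2.
  have -> : k%:~R * abscissa t J p - b%:R * f%:~R =
      b%:R * fracp (k%:~R * abscissa t J p / b%:R).
    by rewrite /fracp -/f; field; rewrite lt0r_neq0.
  by rewrite mulr_gt0//= mulrC -ltr_pdivlMr.
have cbE : abscissa t J p / b%:R = t * J%:R ^+ 2 / b%:R + (i%:R - J%:R) / b%:R.
  by rewrite cE /abscissa_up mulrDl.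
have ab : (i%:R - J%:R) / b%:R <= eta^-1.
  rewrite ler_pdivrMr// mulrC ler_pdivlMr// mulrC; apply: le_trans hb.
  by rewrite ler_pM2l//; lra.
have cb0 : 0 <= abscissa t J p / b%:R by rewrite divr_ge0// ltW.
have n1 : e1 -> ~~ f1.
  move=> /andP[_ h1]; have := nbr 1.
  rewrite mul1r cE -/f1; apply; rewrite -cE.
  have := floor_itv (abscissa t J p / b%:R).
  have : (0 <= Num.floor (abscissa t J p / b%:R)) by rewrite floor_ge0.
  move: (Num.floor _) => f f0 /andP[fl _]; rewrite cbE in fl.
  by apply: (upper_row_in_box bJ f0 fl _ h1); rewrite zE; lra.
have n2 : e2 -> ~~ f2.
  move=> /andP[_ h1]; have := nbr (-1).
  rewrite intrN mulN1r -cE' -/f2; apply; rewrite cE' mulNr.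
  have := floor_itv (- (abscissa t J p / b%:R)).
  have : (Num.floor (- (abscissa t J p / b%:R)) <= 0).
    by rewrite floor_le0 (le_lt_trans _ ltr01)// oppr_le0.
  move: (Num.floor _) => f f0 /andP[_]; rewrite intrD cbE => fl.
  rewrite i'E in h1.
  apply: (lower_row_in_box iJ' _ f0 fl _ h1); first by rewrite lt0n b0 ltnW.
  by rewrite zE; lra.
have z1 : '1[e1] * '1[f1] = 0 :> R.
  by case: (e1) n1 => [/(_ isT)/negbTE->|_]; rewrite ?mulr0 ?mul0r.
have z2 : '1[e2] * '1[f2] = 0 :> R.
  by case: (e2) n2 => [/(_ isT)/negbTE->|_]; rewrite ?mulr0 ?mul0r.
by rewrite z1 z2 !subr0 hb lerDr addr_ge0.
Qed.

Lemma int_near_zero (k : int) :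
  [\/ k = 0, k = 1, k = -1 | (2 <= k) \/ (k <= -2)].
Proof.
have [k2|k2] := leP 2 k; first by apply: Or44; left.
have [k3|k3] := leP k (-2); first by apply: Or44; right.
have : (k == 0) || (k == 1) || (k == -1) by lia.
by case/orP => [/orP[]|] /eqP ->; [apply: Or41|apply: Or42|apply: Or43].
Qed.

(** Conversely, an element q of the window of p other than p itself is in row b + 1
    or b - 1 because t > 1, and then cross p q < eta J is the statement about
    fractional parts.  The negative margin in z makes the in_overlap condition
    necessary. *)
Lemma isolated_ge (R : realType) (t eta z g : R) (J i b : nat) :
  1 < t -> 0 < eta -> 1 < t * J%:R -> 2 + eta <= 2 * (t - 1) * J%:R ->
  z = - (eta^-1 + 2) ->
  (forall p q, p \in lattice_box J -> q \in lattice_box J ->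
     point_angle t J p <= point_angle t J q < point_angle t J p + g ->
     0 <= cross t J p q < eta * J%:R) ->
  (i < 2 * J + 1)%N -> (b < J)%N ->
  '1[eta * J%:R <= b%:R]
  - '1[in_overlap t eta z J i b] *
    '1[fracp (abscissa_up t J i / b%:R) < eta * J%:R / b%:R]
  - '1[in_overlap t eta z J (mirror J i) b] *
    '1[fracp (abscissa_down t J (mirror J i) / b%:R) < eta * J%:R / b%:R]
  <= '1[isolated t g J (i%:Z - J%:Z, b%:Z)] :> R.
Proof.
move=> t1 eta0 tJ bigJ zE far iJ bJ; set i' := mirror J i.
have J0 : 0 < J%:R :> R by rewrite ltr0n (leq_ltn_trans (leq0n b) bJ).
have iJ' : (i <= 2 * J)%N by move: iJ; rewrite addn1.
have iJR : i%:R <= 2 * J%:R :> R by rewrite -natrM ler_nat.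
have i'E : i'%:R = 2 * J%:R - i%:R :> R.
  by rewrite /i' /mirror addn1 subSS natrB ?natrM.
have bJR : b.+1%:R <= J%:R :> R by rewrite ler_nat.
rewrite -natr1 in bJR.
have i0R := ler0n R i; have b0R := ler0n R b.
have eta' : 0 < eta^-1 by rewrite invr_gt0.
set p := (i%:Z - J%:Z, b%:Z).
have p1 : p.1%:~R = i%:R - J%:R :> R by rewrite /p /= intrB -!pmulrn.
have p2 : p.2%:~R = b%:R :> R by [].
have pJ : p \in lattice_box J by apply: (@in_box R); rewrite ?p1 ?p2; lra.
have cE : abscissa t J p = abscissa_up t J i by rewrite /abscissa p1.
have cE' : abscissa_down t J i' = - abscissa t J p.
  by rewrite /abscissa_down i'E /abscissa p1; congr (- _); ring.
clearbody p.
set e1 := in_overlap t eta z J i b; set e2 := in_overlap t eta z J i' b.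
set f1 := fracp _ < _; set f2 := fracp _ < _.
have [hb|_] /= := leP (eta * J%:R) b%:R; last first.
  by rewrite sub0r -opprD (le_trans _ (ler0n _ _))// oppr_le0 addr_ge0// mulr_ge0.
have pos2 : 0 <= '1[e1] * '1[f1] :> R by rewrite mulr_ge0.
have pos3 : 0 <= '1[e2] * '1[f2] :> R by rewrite mulr_ge0.
have [/andP[k1 k2]|n1] := boolP (e1 && f1).
  by rewrite k1 k2 mulr1 subrr; have := ler0n R (isolated t g J p); lra.
have [/andP[k1 k2]|n2] := boolP (e2 && f2).
  by rewrite k1 k2 mulr1 addrAC subrr; have := ler0n R (isolated t g J p); lra.
suff -> : isolated t g J p by rewrite -addrA gerDl -opprD oppr_le0 addr_ge0.
have b0 : 0 < b%:R :> R by rewrite (lt_le_trans _ hb)// mulr_gt0.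
have b0' : (0 < b)%N by rewrite ltr0n in b0.
have cbE : abscissa t J p / b%:R = t * J%:R ^+ 2 / b%:R + (i%:R - J%:R) / b%:R.
  by rewrite cE /abscissa_up mulrDl.
have ab : - eta^-1 <= (i%:R - J%:R) / b%:R.
  rewrite ler_pdivlMr// mulNr lerNl mulrC ler_pdivlMr// mulrC; apply: le_trans hb.
  by rewrite ler_pM2l//; lra.
apply: (@leq_trans (count (pred1 p) (lattice_box J))); last first.
  by rewrite count_uniq_mem ?uniq_lattice_box// leq_b1.
rewrite -!size_filter; apply: uniq_leq_size; first by rewrite filter_uniq ?uniq_lattice_box.
move=> q; rewrite !mem_filter => /andP[/= fq qJ]; rewrite qJ andbT.
have /andP[D0 Dh] := far p q pJ qJ fq.
have [d [k qE]] : exists d k, q = (p.1 + d, p.2 + k).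
  exists (q.1 - p.1), (q.2 - p.2).
  by rewrite !subrKC -surjective_pairing.
have := D0; have := Dh; rewrite qE cross_neighbour p2 => {}Dh {}D0.
have [q1 q1' q20 q2J] := box_bounds R qJ.
rewrite qE /= intrD p1 in q1 q1'; rewrite qE /= intrD p2 in q20 q2J.
have /andP[cl cu] := abscissa_bounds t pJ.
have J1 : 1 * J%:R < t * J%:R by rewrite ltr_pM2r.
have nbr : Num.floor (k%:~R * abscissa t J p / b%:R) = d ->
    fracp (k%:~R * abscissa t J p / b%:R) < eta * J%:R / b%:R.
  rewrite /fracp => ->; rewrite ltr_pdivlMr// mulrBl mulfVK ?lt0r_neq0//.
  by rewrite [d%:~R * _]mulrC.
have fl : (k = 1 \/ k = -1) -> Num.floor (k%:~R * abscissa t J p / b%:R) = d.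
  move=> _; apply: floor_def; rewrite intrD ler_pdivlMr// ltr_pdivrMr//.
  by rewrite mulrDl mul1r [d%:~R * _]mulrC; apply/andP; split; lra.
have J2 : J%:R * (2 + eta) <= J%:R * (2 * (t - 1) * J%:R) by rewrite ler_pM2l.
have c0 : 0 < abscissa t J p.
  by apply: lt_le_trans cl; rewrite mulr_gt0//; lra.
have bJ2 : b%:R <= J%:R :> R by rewrite ler_nat ltnW.
have dJ : d%:~R <= 2 * J%:R :> R by clear -i0R q1'; lra.
have dJ' : - d%:~R <= 2 * J%:R :> R by clear -iJR q1; lra.
have bd1 : b%:R * d%:~R <= 2 * J%:R * J%:R :> R.
  have [d0|d0] := leP 0 (d%:~R : R); first by rewrite mulrC ler_pM.
  by rewrite (@le_trans _ _ 0) ?mulr_ge0 ?(ltW J0)// mulr_ge0_le0// ltW.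
have bd2 : - (b%:R * d%:~R) <= 2 * J%:R * J%:R :> R.
  have [d0|d0] := leP (d%:~R : R) 0.
    by rewrite -mulrN mulrC ler_pM ?oppr_ge0.
  by rewrite (@le_trans _ _ 0) ?mulr_ge0 ?(ltW J0)// oppr_le0 mulr_ge0// ltW.
case: (int_near_zero k) => [k0|k1|k1|[k2|k2]].
- rewrite k0 mul0r sub0r in D0 Dh.
  have d0 : d = 0.
    have [dn|dp|//] := ltgtP d 0.
      have : (d + 1)%:~R <= 0 :> R by rewrite lerz0 lezD1.
      by rewrite intrD => /(mulr_ge0_le0 b0R); rewrite mulrDr mulr1 => ?; exfalso; lra.
    have : 1 <= d%:~R :> R by rewrite ler1z.
    by move=> /(ler_wpM2l b0R); rewrite mulr1 => ?; exfalso; lra.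
  by rewrite d0 k0 !addr0 /= -surjective_pairing eqxx.
- case/negP: n1; have dfl := fl (or_introl k1); have := nbr dfl.
  rewrite k1 mul1r in dfl *; rewrite /f1 -cE => ->; rewrite andbT /e1 /in_overlap hb /=.
  have := floor_itv (abscissa t J p / b%:R); rewrite dfl intrD => /andP[h1 h2].
  by lra.
- case/negP: n2; have dfl := fl (or_intror k1); have := nbr dfl.
  rewrite k1 intrN mulN1r in dfl *; rewrite /f2 cE' => ->; rewrite andbT /e2 /in_overlap hb /=.
  have := floor_itv (- abscissa t J p / b%:R); rewrite dfl intrD => /andP[h1 h2].
  by rewrite mulNr in h1 h2; rewrite i'E; lra.
- exfalso; have : 2 <= k%:~R :> R by rewrite (ler_int _ 2).
  by move=> /(ler_wpM2r (ltW c0)); lra.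
- exfalso; have : k%:~R <= -2 :> R by rewrite (ler_int _ _ (-2)).
  by move=> /(ler_wpM2r (ltW c0)); lra.
Qed.

(** * Counting the gaps *)

Lemma gap_distribution_le (R : realType) (t lambda : R) (J : nat) :
  gap_distribution t J lambda <=
  (count (gap_above t (lambda * average_gap t J) J) (lattice_box J))%:R / (box_card J)%:R.
Proof.
rewrite ler_wpM2r ?invr_ge0// ler_nat.
have := gap_count_le [seq point_angle t J p | p <- lattice_box J] (lambda * average_gap t J).
rewrite size_map size_lattice_box count_map => h; apply: leq_trans h _.
by apply: sub_count => p /=; rewrite has_map.
Qed.

Lemma gap_distribution_ge (R : realType) (t lambda : R) (J : nat) :
  ((count (isolated t (lambda * average_gap t J) J) (lattice_box J))%:R - 1)
    / (box_card J)%:R <= gap_distribution t J lambda.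
Proof.
rewrite ler_wpM2r ?invr_ge0// lerBlDr natr1 ler_nat.
have := gap_count_ge [seq point_angle t J p | p <- lattice_box J] (lambda * average_gap t J).
rewrite size_map size_lattice_box count_map => h; apply: leq_trans h.
by apply: sub_count => p /=; rewrite count_map.
Qed.

Lemma sum_eq0_le (R : realType) (n : nat) : \sum_(i < n) '1[(i == 0 :> nat)%N] <= 2 :> R.
Proof.
have -> : \sum_(i < n) '1[(i == 0 :> nat)%N] = \sum_(i < n) '1[i%:R < 1 :> R] :> R.
  by apply: eq_bigr => i _; rewrite (ltr_nat R i 1) ltnS leqn0.
by apply: le_trans (count_below_le _ _) _; lra.
Qed.

Lemma count_tail_bounds (R : realType) (J : nat) (h : R) : 0 <= h <= J%:R ->
  J%:R - h - 1 <= (\sum_(0 <= b < J) '1[h <= b%:R] : R) <= J%:R - h.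
Proof.
case/andP => h0 hJ; rewrite big_mkord.
have -> : \sum_(b < J) '1[h <= b%:R] = J%:R - \sum_(b < J) '1[b%:R < h] :> R.
  rewrite -[J in J%:R]card_ord -sumr_const -sumrB; apply: eq_bigr => b _.
  by have [_|_] /= := leP h b%:R; rewrite ?subr0 ?subrr.
have := count_below_ge hJ; have := @count_below_le R J h.
by move=> /(_ ltac:(lra)) ? ?; apply/andP; split; lra.
Qed.

Lemma sum_mirror (R : realType) (J : nat) (G : nat -> R) :
  \sum_(i < 2 * J + 1) G (mirror J i) = \sum_(i < 2 * J + 1) G i.
Proof. by rewrite [RHS](reindex_inj rev_ord_inj). Qed.

Lemma abscissa_size (R : realType) (t : R) (J i : nat) : 1 < t -> 1 <= J%:R :> R ->
  (i < 2 * J + 1)%N ->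
  (t - 1) * J%:R ^+ 2 <= `|abscissa_up t J i| <= (t + 1) * J%:R ^+ 2 /\
  (t - 1) * J%:R ^+ 2 <= `|abscissa_down t J i| <= (t + 1) * J%:R ^+ 2.
Proof.
move=> t1 J1; rewrite addn1 ltnS => iJ; rewrite /abscissa_up /abscissa_down normrN.
have iJR : i%:R <= 2 * J%:R :> R by rewrite -natrM ler_nat.
have i0 := ler0n R i.
have J2 : J%:R <= J%:R ^+ 2 :> R by rewrite -[leLHS]expr1 ler_weXn2l.
have t2 : 1 * J%:R ^+ 2 <= t * J%:R ^+ 2 by rewrite ler_wpM2r ?sqr_ge0// ltW.
by split; rewrite ger0_norm ?mulrBl ?mulrDl; try (apply/andP; split); lra.
Qed.

(** The row b = J, the column i = 0 and the row b = 0 contribute O(J), which is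
    negligible against the J^2 points of the box. *)
Lemma gap_distribution_upper (R : realType) (t eta lambda e : R) :
  1 < t -> 0 < eta <= 1 -> eta < lambda * t / 2 -> 0 < e ->
  exists K : R, forall J : nat, K <= J%:R ->
  gap_distribution t J lambda <= 1 - eta - overlap_loss t eta + e.
Proof.
move=> t1 /andP[eta0 eta1] etal e0; have t0 : 0 < t by lra.
have e2 : 0 < e / 2 by lra.
have tm : 0 < t - 1 by lra.
have tp : 0 < t + 1 by lra.
have eta01 : 0 < eta <= 1 by rewrite eta0.
have [K1 H1] := close_of_cross t1 eta0 etal.
have [K2 H2] := @overlap_count R t eta (eta^-1 + 2) (t - 1) (t + 1) (e / 2) t0 eta01 tm tp e2.
pose F := 1 - eta - overlap_loss t eta.
(* The terms of order J will add up to at most (12 + 4 |F + e|) J. *)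
pose K3 := (12 + 4 * `|F + e|) / e.
have K30 : 0 <= K3 by rewrite divr_ge0 ?(ltW e0)// addr_ge0// mulr_ge0.
exists (2 + `|K1| + `|K2| + K3) => J KJ.
have n1 := ler_norm K1; have n2 := ler_norm K2.
have m1 := normr_ge0 K1; have m2 := normr_ge0 K2.
have J1 : 2 <= J%:R :> R by lra.
have {}H1 := H1 J ltac:(lra); have {}H2 := H2 J ltac:(lra).
have tJ : 1 < t * J%:R.
  by have := ler_wpM2r (ler0n R J) (ltW t1); lra.
have J1' : 1 <= J%:R :> R by lra.
have hU i : (i < 2 * J + 1)%N ->
    (t - 1) * J%:R ^+ 2 <= `|abscissa_up t J i| <= (t + 1) * J%:R ^+ 2.
  by move=> hi; have [] := abscissa_size t1 J1' hi.
have hD i : (i < 2 * J + 1)%N ->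
    (t - 1) * J%:R ^+ 2 <= `|abscissa_down t J i| <= (t + 1) * J%:R ^+ 2.
  by move=> hi; have [] := abscissa_size t1 J1' hi.
have [_ lowU] := H2 _ hU; have [_ lowD] := H2 _ hD.
move: lowU lowD; set SU := \sum_(i < _) _; set SD := \sum_(i < _) _ => lowU lowD.
apply: le_trans (gap_distribution_le _ _ _) _.
have N0 : 0 < (box_card J)%:R :> R by rewrite ltr0n muln_gt0 !addn1.
rewrite ler_pdivrMr// -/F.
set g := lambda * _ in H1 *.
have step : (count (gap_above t g J) (lattice_box J))%:R <=
   \sum_(i < 2 * J + 1) (\sum_(0 <= b < J)
     ('1[(i == 0 :> nat)%N] + '1[(b == 0)%N] + '1[eta * J%:R <= b%:R]
     - '1[in_overlap t eta (eta^-1 + 2) J i b] *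
       '1[0 < fracp (abscissa_up t J i / b%:R) < eta * J%:R / b%:R]
     - '1[in_overlap t eta (eta^-1 + 2) J (mirror J i) b] *
       '1[0 < fracp (abscissa_down t J (mirror J i) / b%:R) < eta * J%:R / b%:R]) + 1) :> R.
  rewrite count_box; apply: ler_sum => i _; rewrite addn1 big_nat_recr//=.
  rewrite lerD ?lern1 ?leq_b1// big_nat [leRHS]big_nat; apply: ler_sum => b /andP[_ bJ].
  by apply: gap_above_le.
apply: (le_trans step); rewrite big_split /= sumr_const card_ord.
under eq_bigr do rewrite !sumrB !big_split /=.
rewrite !sumrB !big_split /= -/SU.
rewrite (sum_mirror J (fun i => \sum_(0 <= b < J) '1[in_overlap t eta (eta^-1 + 2) J i b] *
       '1[0 < fracp (abscissa_down t J i / b%:R) < eta * J%:R / b%:R])) -/SD.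
have nR : (2 * J + 1)%:R = 2 * J%:R + 1 :> R by rewrite addn1 -natr1 natrM.
have sA : \sum_(i < 2 * J + 1) \sum_(0 <= b < J) '1[(i == 0 :> nat)%N] <= 2 * J%:R :> R.
  rewrite (eq_bigr (fun i : 'I__ => '1[(i == 0 :> nat)%N] * J%:R)) => [|i _]; last first.
    by rewrite sumr_const_nat subn0 mulr_natr.
  by rewrite -mulr_suml ler_wpM2r// sum_eq0_le.
have sB : \sum_(i < 2 * J + 1) \sum_(0 <= b < J) '1[(b == 0)%N] <= (2 * J%:R + 1) * 2 :> R.
  rewrite sumr_const card_ord -[_ *+ _]mulr_natl nR ler_wpM2l ?addr_ge0 ?mulr_ge0//.
  by rewrite big_mkord sum_eq0_le.
have h01 : 0 <= eta * J%:R <= J%:R by rewrite mulr_ge0 ?(ltW eta0)//= ler_piMl.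
have /andP[_ tail] := count_tail_bounds h01.
have sC : \sum_(i < 2 * J + 1) \sum_(0 <= b < J) '1[eta * J%:R <= b%:R]
    <= (2 * J%:R + 1) * (J%:R - eta * J%:R) :> R.
  by rewrite sumr_const card_ord -[_ *+ _]mulr_natl nR ler_wpM2l ?addr_ge0 ?mulr_ge0//; lra.
rewrite nR box_cardR.
have FJ : - ((F + e) * (3 * J%:R + 1)) <= 4 * `|F + e| * J%:R.
  rewrite -mulNr; apply: (@le_trans _ _ (`|F + e| * (3 * J%:R + 1))).
    rewrite ler_wpM2r ?addr_ge0 ?mulr_ge0//.
    by rewrite (le_trans (ler_norm _))// normrN.
  by rewrite [4 * _]mulrC -mulrA ler_wpM2l//; lra.
have eJ : (12 + 4 * `|F + e|) * J%:R <= e * J%:R ^+ 2.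
  have : K3 <= J%:R by lra.
  rewrite /K3 ler_pdivrMr// => h.
  by have := ler_wpM2r (ler0n R J) h; rewrite expr2; lra.
have etaJ : 0 <= eta * J%:R by case/andP: h01.
have final (L n j A B C U D : R) : 2 <= j -> 0 <= eta * j -> A <= 2 * j ->
    B <= (2 * j + 1) * 2 -> C <= (2 * j + 1) * (j - eta * j) ->
    (L - e / 2) * j ^+ 2 <= U -> (L - e / 2) * j ^+ 2 <= D ->
    - ((1 - eta - L + e) * (3 * j + 1)) <= 4 * n * j ->
    (12 + 4 * n) * j <= e * j ^+ 2 ->
    A + B + C - U - D + (2 * j + 1) <= (1 - eta - L + e) * ((2 * j + 1) * (j + 1)).
  clear; move=> j2 ej hA hB hC hU hD hn he; lra.
exact: final J1 etaJ sA sB sC lowU lowD FJ eJ.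
Qed.

Lemma gap_distribution_lower (R : realType) (t eta lambda e : R) :
  1 < t -> 0 < eta <= 1 -> 0 <= lambda -> lambda * t / 2 < eta -> 0 < e ->
  exists K : R, forall J : nat, K <= J%:R ->
  1 - eta - overlap_loss t eta - e <= gap_distribution t J lambda.
Proof.
move=> t1 /andP[eta0 eta1] l0 etal e0; have t0 : 0 < t by lra.
have e2 : 0 < e / 2 by lra.
have tm : 0 < t - 1 by lra.
have tp : 0 < t + 1 by lra.
have eta01 : 0 < eta <= 1 by rewrite eta0.
have [K1 H1] := cross_of_close t1 l0 etal.
have [K2 H2] := @overlap_count R t eta (- (eta^-1 + 2)) (t - 1) (t + 1) (e / 2) t0 eta01 tm tp e2.
pose F := 1 - eta - overlap_loss t eta.
(* The terms of order J will add up to at most (12 + 4 |F - e|) J. *)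
pose K3 := (12 + 4 * `|F - e|) / e.
have K30 : 0 <= K3 by rewrite divr_ge0 ?(ltW e0)// addr_ge0// mulr_ge0.
pose K4 := (2 + eta) / (2 * (t - 1)).
have K40 : 0 <= K4 by rewrite divr_ge0 ?mulr_ge0 ?(ltW tm)//; lra.
exists (2 + `|K1| + `|K2| + K3 + K4) => J KJ.
have n1 := ler_norm K1; have n2 := ler_norm K2.
have m1 := normr_ge0 K1; have m2 := normr_ge0 K2.
have J1 : 2 <= J%:R :> R by lra.
have J1' : 1 <= J%:R :> R by lra.
have {}H1 := H1 J ltac:(lra); have {}H2 := H2 J ltac:(lra).
have tJ : 1 < t * J%:R.
  by have := ler_wpM2r (ler0n R J) (ltW t1); lra.
have bigJ : 2 + eta <= 2 * (t - 1) * J%:R.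
  have : K4 <= J%:R by lra.
  by rewrite /K4 ler_pdivrMr ?mulr_gt0// [J%:R * _]mulrC.
have hU i : (i < 2 * J + 1)%N ->
    (t - 1) * J%:R ^+ 2 <= `|abscissa_up t J i| <= (t + 1) * J%:R ^+ 2.
  by move=> hi; have [] := abscissa_size t1 J1' hi.
have hD i : (i < 2 * J + 1)%N ->
    (t - 1) * J%:R ^+ 2 <= `|abscissa_down t J i| <= (t + 1) * J%:R ^+ 2.
  by move=> hi; have [] := abscissa_size t1 J1' hi.
have [upU _] := H2 _ hU; have [upD _] := H2 _ hD.
move: upU upD; set SU := \sum_(i < _) _; set SD := \sum_(i < _) _ => upU upD.
apply: le_trans (gap_distribution_ge _ _ _).
have N0 : 0 < (box_card J)%:R :> R by rewrite ltr0n muln_gt0 !addn1.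
rewrite ler_pdivlMr// -/F.
set g := lambda * _ in H1 *.
have step : \sum_(i < 2 * J + 1) (\sum_(0 <= b < J)
     ('1[eta * J%:R <= b%:R]
     - '1[in_overlap t eta (- (eta^-1 + 2)) J i b] *
       '1[fracp (abscissa_up t J i / b%:R) < eta * J%:R / b%:R]
     - '1[in_overlap t eta (- (eta^-1 + 2)) J (mirror J i) b] *
       '1[fracp (abscissa_down t J (mirror J i) / b%:R) < eta * J%:R / b%:R]))
    <= (count (isolated t g J) (lattice_box J))%:R :> R.
  rewrite count_box; apply: ler_sum => i _; rewrite (addn1 J) [leRHS]big_nat_recr//=.
  rewrite -[leLHS]addr0 lerD// big_nat [leRHS]big_nat; apply: ler_sum => b /andP[_ bJ].
  by apply: isolated_ge.
rewrite lerBrDr; apply: le_trans step.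
under eq_bigr do rewrite !sumrB.
rewrite !sumrB -/SU.
rewrite (sum_mirror J (fun i => \sum_(0 <= b < J) '1[in_overlap t eta (- (eta^-1 + 2)) J i b] *
       '1[fracp (abscissa_down t J i / b%:R) < eta * J%:R / b%:R])) -/SD.
have nR : (2 * J + 1)%:R = 2 * J%:R + 1 :> R by rewrite addn1 -natr1 natrM.
have h01 : 0 <= eta * J%:R <= J%:R by rewrite mulr_ge0 ?(ltW eta0)//= ler_piMl.
have /andP[tail _] := count_tail_bounds h01.
have sC : (2 * J%:R + 1) * (J%:R - eta * J%:R - 1) <=
    \sum_(i < 2 * J + 1) \sum_(0 <= b < J) '1[eta * J%:R <= b%:R] :> R.
  rewrite sumr_const card_ord -[leRHS]mulr_natl nR.
  by rewrite ler_wpM2l ?addr_ge0 ?mulr_ge0.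
rewrite box_cardR.
have FJ : (F - e) * (3 * J%:R + 1) <= 4 * `|F - e| * J%:R.
  apply: (@le_trans _ _ (`|F - e| * (3 * J%:R + 1))).
    by rewrite ler_wpM2r ?addr_ge0 ?mulr_ge0// ler_norm.
  by rewrite [4 * _]mulrC -mulrA ler_wpM2l//; lra.
have eJ : (12 + 4 * `|F - e|) * J%:R <= e * J%:R ^+ 2.
  have : K3 <= J%:R by lra.
  rewrite /K3 ler_pdivrMr// => h.
  by have := ler_wpM2r (ler0n R J) h; rewrite expr2; lra.
have final (L n j C U D : R) : 2 <= j -> eta * j <= j ->
    (2 * j + 1) * (j - eta * j - 1) <= C ->
    U <= (L + e / 2) * j ^+ 2 -> D <= (L + e / 2) * j ^+ 2 ->
    (1 - eta - L - e) * (3 * j + 1) <= 4 * n * j ->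
    (12 + 4 * n) * j <= e * j ^+ 2 ->
    (1 - eta - L - e) * ((2 * j + 1) * (j + 1)) + 1 <= C - U - D.
  clear; move=> j2 ej hC hU hD hn he; lra.
by case/andP: h01 => _ etaJ; exact: final J1 etaJ sC upU upD FJ eJ.
Qed.

(** The limit of the gap distribution as a function of min (1, lambda t / 2). *)
Definition limit_profile (R : realType) (t x : R) : R := 1 - x - overlap_loss t x.

Lemma continuous_limit_profile (R : realType) (t : R) : 0 < t -> continuous (limit_profile t).
Proof.
move=> t0 x; rewrite /limit_profile /overlap_loss.
have b0 : overlap_start t x != 0.
  by rewrite lt0r_neq0// /overlap_start lt_min ltr01 lt_max divr_gt0 ?orbT.
have cb : {for x, continuous (overlap_start t)}.
  rewrite /overlap_start; apply: continuous_min; first exact: cvg_cst.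
  by apply: continuous_max; [exact: cvg_id|exact: cvg_cst].
apply: cvgB; first by apply: cvgB; [exact: cvg_cst|exact: cvg_id].
apply: cvgM; first exact: cvg_id.
apply: cvgB; last first.
  by apply: cvgM; [exact: cvg_cst|apply: cvgV].
apply: cvgB; first exact: cvg_cst.
apply: cvgM; first exact: cvg_cst.
apply: (@continuous_comp _ _ _ (overlap_start t) (@ln R)) => //.
by apply: continuous_ln; rewrite /overlap_start lt_min ltr01 lt_max divr_gt0 ?orbT.
Qed.

(** * The limit *)

Lemma gap_distribution_01 (R : realType) (t lambda : R) (J : nat) :
  0 <= gap_distribution t J lambda <= 1.
Proof.
have N0 : 0 < (box_card J)%:R :> R by rewrite ltr0n muln_gt0 !addn1.
rewrite divr_ge0//= ler_pdivrMr// mul1r ler_nat (leq_trans (count_size _ _))//.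
by rewrite size_iota leq_subr.
Qed.

Lemma gap_distribution_cvg (R : realType) (t lambda : R) : 1 < t -> 0 <= lambda ->
  gap_distribution t J lambda @[J --> \oo] -->
  limit_profile t (Num.min 1 (lambda * t / 2)).
Proof.
move=> t1 l0; have t0 : 0 < t by lra.
set x0 := lambda * t / 2; set x := Num.min 1 x0.
have x00 : 0 <= x0 by rewrite divr_ge0// mulr_ge0// ltW.
have profile1 : limit_profile t 1 = 0.
  rewrite /limit_profile /overlap_loss (_ : overlap_start t 1 = 1).
    by rewrite ln1; field.
  by rewrite /overlap_start; apply/min_idPl; rewrite le_max lexx.
have profile0 : limit_profile t 0 = 1.
  by rewrite /limit_profile /overlap_loss mul0r !subr0.
apply/cvgrPdist_le => e e0; have e2 : 0 < e / 2 by lra.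
have := @continuous_limit_profile R t t0 x.
move=> /cvgrPdist_le /(_ _ e2) [d /= d0 Hd].
have near_profile y : `|x - y| < d -> `|limit_profile t x - limit_profile t y| <= e / 2.
  exact: Hd.
have lower : \forall J \near \oo, limit_profile t x - e <= gap_distribution t J lambda.
  have [x1|x1] := leP 1 x0.
    rewrite /x min_l// profile1; apply: nearW => J.
    by have /andP[h _] := gap_distribution_01 t lambda J; lra.
  have xE : x = x0 by rewrite /x min_r// ltW.
  pose y := Num.min 1 (x0 + d / 2).
  have y1 : y <= 1 by rewrite /y ge_min lexx.
  have xy : x0 < y by rewrite /y lt_min x1 /=; lra.
  have yd : y <= x0 + d / 2 by rewrite /y ge_min lexx orbT.
  have y01 : 0 < y <= 1 by rewrite y1 andbT; lra.
  have [K HK] := gap_distribution_lower t1 y01 l0 xy e2.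
  have /near_profile : `|x - y| < d by rewrite xE ltr_norml; apply/andP; split; lra.
  rewrite ler_norml => /andP[h1 h2].
  near=> J; have := HK J; rewrite -/(limit_profile t y) => h.
  have : limit_profile t y - e / 2 <= gap_distribution t J lambda.
    by apply: h; near: J; exact: nbhs_infty_ger.
  by lra.
have upper : \forall J \near \oo, gap_distribution t J lambda <= limit_profile t x + e.
  have [x0E|x0n] := eqVneq x0 0.
    rewrite /x min_r ?x0E ?ler01// profile0; apply: nearW => J.
    by have /andP[_ h] := gap_distribution_01 t lambda J; lra.
  have x0p : 0 < x0 by rewrite lt_neqAle eq_sym x0n.
  have xp : 0 < x by rewrite /x lt_min ltr01.
  have xx0 : x <= x0 by rewrite /x ge_min lexx orbT.
  have x1 : x <= 1 by rewrite /x ge_min lexx.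
  pose y := Num.max (x / 2) (x - d / 2).
  have yx2 : x / 2 <= y by rewrite /y le_max lexx.
  have yxd : x - d / 2 <= y by rewrite /y le_max lexx orbT.
  have yx : y < x by rewrite /y gt_max; apply/andP; split; lra.
  have y01 : 0 < y <= 1 by apply/andP; split; lra.
  have yx0 : y < x0 by lra.
  have [K HK] := gap_distribution_upper t1 y01 yx0 e2.
  have /near_profile : `|x - y| < d by rewrite ltr_norml; apply/andP; split; lra.
  rewrite ler_norml => /andP[h1 h2].
  near=> J; have := HK J; rewrite -/(limit_profile t y) => h.
  have : gap_distribution t J lambda <= limit_profile t y + e / 2.
    by apply: h; near: J; exact: nbhs_infty_ger.
  by lra.
near=> J; rewrite ler_norml; apply/andP; split.
  have : gap_distribution t J lambda <= limit_profile t x + e by near: J.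
  by lra.
have : limit_profile t x - e <= gap_distribution t J lambda by near: J.
by lra.
Unshelve. all: by end_near. Qed.

Unset Implicit Arguments.

Theorem theorem2p1 (R : realType) (t : R) (t_gt0 : 0 < t)
    (lambda : R) (lambda_ge0 : 0 <= lambda) :
  (2 < t ->
     (lambda <= 2 / t ->
        gap_distribution t J lambda @[J --> \oo] --> 1 - lambda * t / 2) /\
     (2 / t <= lambda ->
        gap_distribution t J lambda @[J --> \oo] --> (0 : R)))
  /\
  (1 < t <= 2 ->
     (lambda <= 1 ->
        gap_distribution t J lambda @[J --> \oo] -->
          1 + lambda * t / 2 + lambda * t * ln (t / 2) - lambda * t ^+ 2 / 2) /\
     (1 <= lambda <= 2 / t ->
        gap_distribution t J lambda @[J --> \oo] -->
          1 - lambda * t / 2 + lambda * t * ln (lambda * t / 2)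
            - lambda * t ^+ 2 / 2 + t) /\
     (2 / t <= lambda ->
        gap_distribution t J lambda @[J --> \oo] --> (0 : R))).
Proof.
have cvg (t1 : 1 < t) := gap_distribution_cvg t1 lambda_ge0.
have small : (lambda <= 2 / t) = (lambda * t / 2 <= 1).
  by rewrite ler_pdivlMr// ler_pdivrMr// mul1r.
have big : (2 / t <= lambda) = (1 <= lambda * t / 2).
  by rewrite ler_pdivrMr// ler_pdivlMr// mul1r.
have zero (t1 : 1 < t) : 1 <= lambda * t / 2 ->
    gap_distribution t J lambda @[J --> \oo] --> (0 : R).
  move=> x1; rewrite (_ : 0 = limit_profile t (Num.min 1 (lambda * t / 2))); first exact: cvg.
  rewrite min_l// /limit_profile /overlap_loss (_ : overlap_start t 1 = 1).
    by rewrite ln1; field.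
  by rewrite /overlap_start; apply/min_idPl; rewrite le_max lexx.
split=> [t2|/andP[t1 t2]].
  have t1 : 1 < t by lra.
  split=> [|h]; last by apply: zero => //; rewrite -big.
  rewrite small => x1; have := cvg t1; rewrite min_r//.
  suff -> : limit_profile t (lambda * t / 2) = 1 - lambda * t / 2 by [].
  rewrite /limit_profile /overlap_loss (_ : overlap_start t _ = 1).
    by rewrite ln1; field.
  by rewrite /overlap_start; apply/min_idPl; rewrite le_max; apply/orP; right; lra.
split=> [l1|].
  have xt : lambda * t / 2 <= t / 2.
    by rewrite -mulrA ler_piMl// divr_ge0// ltW.
  have := cvg t1; rewrite min_r; last by lra.
  suff -> : limit_profile t (lambda * t / 2) = 1 + lambda * t / 2 +
      lambda * t * ln (t / 2) - lambda * t ^+ 2 / 2 by [].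
  rewrite /limit_profile /overlap_loss (_ : overlap_start t _ = t / 2).
    by field; rewrite lt0r_neq0.
  by rewrite /overlap_start max_r// min_r//; lra.
split=> [/andP[l1]|h]; last by apply: zero => //; rewrite -big.
rewrite small => x1; have := cvg t1; rewrite min_r//.
have xt : t / 2 <= lambda * t / 2.
  by rewrite -mulrA ler_peMl// divr_ge0// ltW.
have l0 : 0 < lambda by lra.
suff -> : limit_profile t (lambda * t / 2) = 1 - lambda * t / 2 +
    lambda * t * ln (lambda * t / 2) - lambda * t ^+ 2 / 2 + t by [].
rewrite /limit_profile /overlap_loss (_ : overlap_start t _ = lambda * t / 2).
  by field; rewrite !lt0r_neq0.
by rewrite /overlap_start max_l// min_r.
Qed.
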